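(* Let $\theta\in(0,1)$ be an irrational number, and let $(c_0,c_1,c_2,\dots)$ be the sequence of positive integers such that $\theta=\cfrac{1}{c_0+\cfrac{1}{c_1+\cfrac{1}{c_2+\cdots}}}$. Then the (unordered) Bratteli diagram $\mathsf B$ associated with the sequence of RK-sets $\mathcal A_0\prec\mathcal A_1\prec\mathcal A_2\prec\cdots$ of $\theta$ is described as follows. The $n$-th level vertex set is $V_n=\{0,1\}$ for $n\ge0$. If $\theta_{n-1}<1/2$ (equivalently $c_{n-1}\ge2$), then $0\in V_{n-1}$ is connected to $0,1\in V_n$ each by a single edge, and $1\in V_{n-1}$ is connected to $0\in V_n$ by $c_{n-1}$ edges and to $1\in V_n$ by $c_{n-1}-1$ edges. If $\theta_{n-1}>1/2$ (equivalently $c_{n-1}=1$), then $0\in V_{n-1}$ is connected to $0,1\in V_n$ each by a single edge, and $1\in V_{n-1}$ is connected to $0\in V_n$ by a single edge. The set of edges $E_n$, $n\ge1$, satisfies $\mathbf s(E_n)=V_{n-1}$ and $\mathbf r(E_n)=V_n$. The natural action $\Omega(\mathsf B)\curvearrowleft D_\infty$ is topologically conjugate to the action $\mathcal X_\theta\curvearrowleft D_\infty$.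
   Context: **The space $\mathcal X_\theta$.** For irrational $\theta\in(0,1)$, let $a:x\mapsto1-x$, $b:x\mapsto\theta-x$ be reflections of $\mathbb R/\mathbb Z$ (right actions), generating $D_\infty$. $\mathcal X_\theta$ is the Cantor set obtained from the circle by replacing each point $x$ of the orbit of $0$ (i.e. $x\in\mathbb Z\theta+\mathbb{Z}$) by two points $x-0$, $x+0$, with $0=0+0$ and $1=0-0$; the action lifts by $(x-0)\cdot g=x\cdot g+0$, $(x+0)\cdot g=x\cdot g-0$ for $g\in\{a,b\}$. For $p<q$ in the orbit of $0$, $[p,q]$ denotes the clopen interval from $p+0$ to $q-0$. **Towers.** Put $\theta_0=\theta$, $c_{n-1}=\lfloor1/\theta_{n-1}\rfloor$, $\theta_{n-1}=1/(c_{n-1}+\theta_n)$. $\mathcal A_0$ consists of the towers $\mathcal F_{0,0}=\{[0,\theta]\}$, $\mathcal F_{1,0}=\{[\theta,1]\}$. For $n\ge1$, write $c=c_{n-1}$, $\vartheta=\theta_{n-1}$; in $\mathcal X_\vartheta$ with generators $a^{(n)}:x\mapsto1-x$, $b^{(n)}:x\mapsto\vartheta-x$, the RK-set $\mathcal A_n$ consists of two towers: $\mathcal F_{0,n}$ with floors $[i\vartheta,1-(c-i)\vartheta]$, $0\le i\le c$, and base $I_0^{(n)}=[0,1-c\vartheta]$; and $\mathcal F_{1,n}$ with floors $[1-(c-i)\vartheta,(i+1)\vartheta]$, $0\le i\le c-1$, and base $J_0^{(n)}=[1-c\vartheta,\vartheta]$. The floors partition $\mathcal X_\vartheta$. They are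 listed as $I_0^{(n)},\dots,I_c^{(n)}$ and $J_0^{(n)},\dots,J_{c-1}^{(n)}$ in the order of successive images of the base under $a^{(n)},b^{(n)},a^{(n)},\dots$ (so consecutive floors in a list are interchanged alternately by $a^{(n)},b^{(n)},\dots$, the first pair by $a^{(n)}$). The similarity $x\mapsto x/\vartheta$ maps $[0,\vartheta]$ onto $[0,1]$ (i.e. onto $\mathcal X_{\theta_n}$), $I_0^{(n)}$ onto $[0,\theta_n]$ and $J_0^{(n)}$ onto $[\theta_n,1]$. **Associated diagram.** The vertices $0,1\in V_n$ correspond to $\mathcal F_{0,n},\mathcal F_{1,n}$. Edges from $j\in V_{n-1}$ to $k\in V_n$ correspond to the floors of $\mathcal F_{k,n}$ contained in $[0,\theta_{n-1}]$ if $j=0$, and in $[\theta_{n-1},1]$ if $j=1$ (these being the rescaled bases of the towers of $\mathcal A_{n-1}$). So $E_n$ is identified with the set of floors of $\mathcal A_n$. Paths are written right to left, $\dots e_2e_1$, with the range of $e_i$ equal to the source of $e_{i+1}$; $\Omega(\mathsf B)$ is the space of infinite paths starting in $V_0$ (topology induced from the product). **Natural action.** On the space of infinite paths $p=\dots e_{i+1}e_i$ starting in $V_{i-1}$, $a^{(i)},b^{(i)}$ act recursively. Let $x$ be $a$ or $b$. (i) If $x^{(i)}$ interchanges the floor $e_i$ with the neighboring floor $e_i'$ in its list, then $p\cdot x^{(i)}=\dots e_{i+1}e_i'$. (ii) If $e_i\in\{I_0^{(i)},J_0^{(i)}\}$, then $p\cdot b^{(i)}=q\,e'$, where $q=(\dots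 e_{i+2}e_{i+1})\cdot a^{(i+1)}$ and $e'\in\{I_0^{(i)},J_0^{(i)}\}$ is the edge whose range is the source of the first edge of $q$. (iii) If $e_i$ is the last floor of its list and $x^{(i)}$ is the generator not joining it to its predecessor (for $c_{i-1}=1$ and $e_i=J_0^{(i)}$, take $x=a$), then $p\cdot x^{(i)}=\big((\dots e_{i+2}e_{i+1})\cdot b^{(i+1)}\big)e_i$. The natural action of $D_\infty=\langle a,b\rangle$ on $\Omega(\mathsf B)$ is given by $a=a^{(1)}$, $b=b^{(1)}$. *)

(* Defs.v *)
From HB Require Import structures.
From mathcomp Require Import all_boot all_order all_algebra.
From mathcomp Require Import all_classical all_reals all_analysis.

Set Implicit Arguments.
Unset Strict Implicit.
Unset Printing Implicit Defensive.

Import Order.TTheory GRing.Theory Num.Theory.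
Import numFieldNormedType.Exports.

Local Open Scope classical_set_scope.
Local Open Scope ring_scope.

(* The infinite dihedral group is the free product of two groups of order 2,
   so a right action of it by homeomorphisms is a pair of continuous
   involutions, the images of its generators a and b. *)
Inductive gen := Ga | Gb.

Definition Dinf_action (T : topologicalType) (act : T -> gen -> T) : Prop :=
  forall g, continuous (act^~ g) /\ involutive (act^~ g).

Definition homeomorphism (T U : topologicalType) (f : T -> U) : Prop :=
  continuous f /\ exists h : U -> T, [/\ continuous h, cancel f h & cancel h f].

(* Equivariance under a and b is equivariance under the group they generate. *)
Definition topologically_conjugate (T U : topologicalType)
    (actT : T -> gen -> T) (actU : U -> gen -> U) : Prop :=
  exists f : T -> U,
    homeomorphism f /\ forall x g, f (actT x g) = actU (f x) g.

(* [br] lands in level [n.+1]: [bE B n] is the edge set E_{n+1}. *)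
Record bratteli := Bratteli {
  bV : nat -> finType;
  bE : nat -> finType;
  bs : forall n, bE n -> bV n;
  br : forall n, bE n -> bV n.+1 }.

Definition edge_count (B : bratteli) n (j : bV B n) (k : bV B n.+1) : nat :=
  #|[pred e : bE B n | (bs e == j) && (br e == k)]|.

Definition path_set (B : bratteli) :
    set (prod_topology (fun n => discrete_topology (bE B n))) :=
  [set p | forall n, @br B n (p n) = @bs B n.+1 (p n.+1)].

Arguments path_set : clear implicits.

(* The path space, with the topology induced from the product. *)
Definition Omega (B : bratteli) : topologicalType := set_type (path_set B).

Definition edge_at (B : bratteli) (p : Omega B) (n : nat) : bE B n :=
  set_val p n.

Definition btail (B : bratteli) : bratteli :=
  Bratteli (fun n e => @bs B n.+1 e) (fun n e => @br B n.+1 e).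

Lemma tail_subproof (B : bratteli) (p : Omega B) :
  (fun n => set_val p n.+1) \in path_set (btail B).
Proof. by apply/mem_set => n; have /set_mem := valP p; exact. Qed.

Definition ptail (B : bratteli) (p : Omega B) : Omega (btail B) :=
  SigSub (tail_subproof p).

(* p = q e, paths being written right to left *)
Definition is_cons (B : bratteli) (p : Omega B) (e : bE B 0)
    (q : Omega (btail B)) : Prop :=
  edge_at p 0 = e /\ ptail p = q.

Section CantorCircle.
Variable (R : realType).
Implicit Types (theta x p q : R).

Definition orbit0 theta : set R :=
  [set x | exists m n : int, x = m%:~R * theta + n%:~R].

Definition frac x : R := x - (Num.floor x)%:~R.

(* (x, true) is x + 0 and (x, false) is x - 0.  The circle is cut open at 0
   into [0, 1], so that 0 + 0 is (0, true) and 0 - 0 is (1, false); a point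
   outside the orbit of 0 is not doubled and is represented by (x, true). *)
Definition X_pred theta (u : R *l bool) : bool :=
  [&& 0 <= u.1 <= 1, (u.1 == 0) ==> u.2, (u.1 == 1) ==> ~~ u.2
    & (u.1 \in orbit0 theta) || u.2].

Record X_space theta := XPoint { X_val : R *l bool; _ : X_pred theta X_val }.

HB.instance Definition _ theta := [isSub for @X_val theta].
HB.instance Definition _ theta := [Choice of X_space theta by <:].
HB.instance Definition _ theta :=
  [SubChoice_isSubOrder of X_space theta by <:
    with Order.lexi_display ring_display Order.BoolOrder.bool_display].
HB.instance Definition _ theta :=
  OrderTopological.copy (X_space theta) (order_topology (X_space theta)).


Lemma cut_subproof theta x (s : bool) :
  X_pred theta (if (frac x == 0) && ~~ s then (1, false)
                else (frac x, s || (frac x \notin orbit0 theta))).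
Proof.
have /andP[f0 f1] : 0 <= frac x < 1.
  have := Num.Theory.floor_itv x.
  by rewrite /frac intrD subr_ge0 ltrBlDl => /andP[-> ->].
rewrite /X_pred; case: ifPn => [_|].
  rewrite [_.1]/= [_.2]/= ler01 lexx oner_eq0 eqxx orbF.
  by apply/mem_set; exists 0, 1; rewrite mul0r add0r.
rewrite negb_and negbK [_.1]/= [_.2]/= f0 (ltW f1) (lt_eqF f1) => fs.
apply/and3P; split=> //; first by case: eqP fs => //= _ ->.
by rewrite orbCA orbN orbT.
Qed.

(* The point x + 0 (if [s]) or x - 0 (if [~~ s]) over the point x of R/Z. *)
Definition cut theta x (s : bool) : X_space theta :=
  XPoint (cut_subproof theta x s).

Definition reflection theta (g : gen) x : R :=
  match g with Ga => 1 - x | Gb => theta - x end.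

Definition X_act theta (u : X_space theta) (g : gen) : X_space theta :=
  cut theta (reflection theta g (X_val u).1) (~~ (X_val u).2).

(* [p, q] *)
Definition X_itv theta p q : set (X_space theta) :=
  [set` `[cut theta p true, cut theta q false]].

End CantorCircle.

Arguments X_itv {R} theta p q _.

Section Towers.
Variable R : realType.
Implicit Types (theta : R) (t : nat -> R) (c : nat).

Definition cf theta : nat := Num.truncn theta^-1.

Definition gauss theta : R := theta^-1 - (cf theta)%:R.

Definition theta_seq theta : nat -> R := fun n => iter n gauss theta.

Fixpoint cfrac (c : nat -> nat) (n : nat) : R :=
  if n is m.+1 then ((c 0)%:R + cfrac (fun i => c i.+1) m)^-1 else 0.

(* The bases of the towers of A_0, and the sets which the rescaling maps onto
   the bases of the towers of the preceding RK-set. *)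
Definition base theta (j : 'I_2) : set (X_space theta) :=
  if j == ord0 then X_itv theta 0 theta else X_itv theta theta 1.

Arguments base theta j _ : clear implicits.

(* The towers of index 0 and 1 have c + 1 and c floors; [existT _ k j] stands
   for the floor I_j (if k = 0) or J_j (if k = 1). *)
Definition floors c : finType := {k : 'I_2 & 'I_(c.+1 - k)}.

Definition tower c (e : floors c) : 'I_2 := tag e.

Definition rank c (e : floors c) : nat := tagged e.

(* The floors of a tower, numbered from left to right. *)
Definition tower_floor theta (k : 'I_2) (i : nat) : set (X_space theta) :=
  let c := (cf theta)%:R in
  if k == ord0 then X_itv theta (i%:R * theta) (1 - (c - i%:R) * theta)
  else X_itv theta (1 - (c - i%:R) * theta) (i.+1%:R * theta).

Arguments tower_floor theta k i _ : clear implicits.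

(* Under a an interval [p, q] goes to [1 - q, 1 - p], and under b, if
   theta <= p, to [1 + theta - q, 1 + theta - p].  Hence, with m the largest
   index in the tower, a exchanges the indices i and m - i, and b exchanges
   i and m + 1 - i for i > 0; so the successive images of the base under
   a, b, a, ... have indices 0, m, 1, m - 1, 2, ... *)
Definition itv_index c (e : floors c) : nat :=
  if odd (rank e) then (c - tower e - (rank e)./2)%N else (rank e)./2.

Definition floor_set theta (e : floors (cf theta)) : set (X_space theta) :=
  tower_floor theta (tower e) (itv_index e).

Arguments floor_set theta e _ : clear implicits.

(* The generator interchanging the floors of ranks j and j + 1. *)
Definition step_gen (j : nat) : gen := if odd j then Gb else Ga.

Definition neighbors c (x : gen) (e e' : floors c) : Prop :=
  tower e = tower e' /\
  ((rank e' = (rank e).+1 /\ x = step_gen (rank e)) \/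
   (rank e = (rank e').+1 /\ x = step_gen (rank e'))).

(* [e] is the last floor of its list and [x] does not join it to its
   predecessor; for a list with a single floor, [x] is a. *)
Definition outer c (x : gen) (e : floors c) : Prop :=
  (rank e).+1 = (c.+1 - tower e)%N /\ x = step_gen (rank e).

Definition floor_source theta (e : floors (cf theta)) : 'I_2 :=
  odflt ord0 [pick j : 'I_2 | `[< floor_set theta e `<=` base theta j >]].

Arguments floor_source theta e : clear implicits.

(* The diagram of the RK-sets for the parameters t 0, t 1, ... *)
Definition tower_diagram t : bratteli :=
  @Bratteli (fun=> 'I_2) (fun n => floors (cf (t n)))
    (fun n => floor_source (t n)) (fun n => @tower (cf (t n))).

Definition seq_shift t : nat -> R := fun n => t n.+1.

Definition tail_diagram theta (i : nat) : bratteli :=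
  tower_diagram (iter i seq_shift (theta_seq theta)).

(* [act i] gives a^(i+1) and b^(i+1), acting on the infinite paths that start
   in V_i; these are the infinite paths of [tail_diagram theta i]. *)
Definition natural_action theta
    (act : forall i, Omega (tail_diagram theta i) -> gen ->
                     Omega (tail_diagram theta i)) : Prop :=
  forall i (p : Omega (tail_diagram theta i)),
    let e := edge_at p 0 in
    let p' : Omega (tail_diagram theta i.+1) := ptail p in
  [/\ forall x e', neighbors x e e' -> is_cons (act i p x) e' p',
      rank e = 0%N ->
        let q := act i.+1 p' Ga in
        exists e', [/\ rank e' = 0%N, tower e' = bs (edge_at q 0)
                     & is_cons (act i p Gb) e' q]
    & forall x, outer x e ->
        is_cons (act i p x) e (act i.+1 p' Gb)].

End Towers.

Arguments base {R} theta j _.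
Arguments tower_floor {R} theta k i _.
Arguments floor_set {R} theta e _.
Arguments floor_source {R} theta e.

(* Main.v *)
(* A point u of X_theta lies in one floor of A_1, say of rank r in tower k, so
   it is the image under r alternating reflections of a point of the base of
   that tower; rescaling the base turns this point into a point w of X_theta',
   theta' = 1/theta - floor(1/theta).  Iterating u |-> (floor, w) gives a code
   of u, which is a path of the diagram.  Rules (i)-(iii) are then identities
   between reflections of the line: the reflection a or b either moves u to the
   next floor with the same w, or fixes the floor and acts on w by b, or fixes
   [0, theta] and acts on w by a.

   The points whose code has a given prefix form a clopen interval.  Nested
   intervals meet by completeness of the reals, so each path is a code.  Two
   points with the same code project to the same real since the intervals
   shrink, and the two copies of a doubled point m theta + k get separated
   because the coefficient m decreases along the code.  Intervals being convex,
   the coding is a homeomorphism for the order topology.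

   The action on paths is unique, and continuous, since the rules determine the
   n-th edge of the image from the first n + 2 edges of the path. *)

Require Import Defs.
From HB Require Import structures.
From mathcomp Require Import all_boot all_order all_algebra.
From mathcomp Require Import all_classical all_reals all_analysis.
From mathcomp Require Import ring lra zify.
Import Order.TTheory GRing.Theory Num.Theory.
Import numFieldNormedType.Exports.
Local Open Scope classical_set_scope.
Local Open Scope ring_scope.

Set Implicit Arguments.
Unset Strict Implicit.
Unset Printing Implicit Defensive.

(** * The points of X_theta and the reflections *)

Section Orbit.
Variables (R : realType) (theta : R).
Implicit Types x y : R.

Lemma orbit0_int (z : int) : orbit0 theta z%:~R.
Proof. by exists 0, z; rewrite mul0r add0r. Qed.

Lemma orbit0_0 : orbit0 theta 0.
Proof. exact: orbit0_int 0. Qed.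

Lemma orbit0_1 : orbit0 theta 1.
Proof. exact: orbit0_int 1. Qed.

Lemma orbit0_theta : orbit0 theta theta.
Proof. by exists 1, 0; rewrite mul1r addr0. Qed.

Lemma orbit0D x y : orbit0 theta x -> orbit0 theta y -> orbit0 theta (x + y).
Proof.
move=> [m [n ->]] [p [q ->]]; exists (m + p), (n + q).
by rewrite !intrD; ring.
Qed.

Lemma orbit0N x : orbit0 theta x -> orbit0 theta (- x).
Proof.
by move=> [m [n ->]]; exists (- m), (- n); rewrite !intrN; ring.
Qed.

Lemma orbit0B x y : orbit0 theta x -> orbit0 theta y -> orbit0 theta (x - y).
Proof. by move=> hx /orbit0N; exact: orbit0D. Qed.

End Orbit.


(** * Points, reflections and intervals in coordinates *)

Section Points.
Variables (R : realType) (theta : R).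
Implicit Types (u v : X_space theta) (x : R) (s : bool).

Lemma X_valP u : [/\ 0 <= (X_val u).1 <= 1,
  (X_val u).1 = 0 -> (X_val u).2 = true,
  (X_val u).1 = 1 -> (X_val u).2 = false &
  orbit0 theta (X_val u).1 \/ (X_val u).2 = true].
Proof.
case: u => -[x s] /= /and4P[-> /= h0 h1 ho]; split => //.
- by move=> /eqP x0; rewrite x0 in h0.
- by move=> /eqP x1; rewrite x1 in h1; apply/negbTE.
- by case/orP: ho => [/set_mem|]; [left|right].
Qed.

(** Both coordinates lie in [0, 1], so z is -1, 0 or 1. For z = 1 or z = -1 the coordinates are 0
    and 1, whose forced flags differ. *)
Lemma X_eq_mod u v (z : int) : (X_val u).1 = (X_val v).1 + z%:~R ->
  (orbit0 theta (X_val u).1 -> (X_val u).2 = (X_val v).2) -> u = v.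
Proof.
move=> E S; suff e1 : (X_val u).1 = (X_val v).1.
  apply: val_inj => /=.
  have [_ _ _ hu] := X_valP u; have [_ _ _ hv] := X_valP v.
  rewrite [X_val u]surjective_pairing [X_val v]surjective_pairing e1.
  congr pair; case: hu => [/S//|e2]; case: hv => [|->//].
  by rewrite -e1 => /S.
have [/andP[u0 u1] ul ur _] := X_valP u.
have [/andP[v0 v1] vl vr _] := X_valP v.
have zi : (-1 <= z <= 1)%R.
  by rewrite -!(ler_int R) intrN; apply/andP; split; lra.
have : z = 0 \/ z = 1 \/ z = -1 by lia.
case=> [z0|[z1|z1]]; first by rewrite z0 addr0 in E.
- rewrite z1 in E; have eu : (X_val u).1 = 1 by lra.
  have ev : (X_val v).1 = 0 by lra.
  have := S; rewrite (ur eu) (vl ev) eu => /(_ (orbit0_1 _)) //.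
- rewrite z1 intrN in E; have eu : (X_val u).1 = 0 by lra.
  have ev : (X_val v).1 = 1 by lra.
  have := S; rewrite (ul eu) (vr ev) eu => /(_ (orbit0_0 _)) //.
Qed.

(** Off the orbit the flag has to be [true], so the prescribed s is granted only on the orbit. *)
Lemma X_exists x s : 0 <= x <= 1 -> (x = 0 -> s = true) ->
  (x = 1 -> s = false) ->
  exists u, (X_val u).1 = x /\ (orbit0 theta x -> (X_val u).2 = s).
Proof.
move=> x01 h0 h1.
have P : X_pred theta (x, s || (x \notin orbit0 theta)).
  rewrite /X_pred /= x01 /=; apply/and3P; split.
  - by apply/implyP => /eqP/h0 ->.
  - apply/implyP => /eqP x1; rewrite h1 //= negbK x1.
    exact/mem_set/orbit0_1.
  - by rewrite orbCA orbN orbT.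
by exists (XPoint P); split => //= /mem_set ->; rewrite orbF.
Qed.

(** Modulo 1, the reflection g is x |-> [pivot g] - x. *)
Definition pivot (g : gen) : R := if g is Gb then theta else 0.

Lemma orbit0_pivot g : orbit0 theta (pivot g).
Proof. by case: g; [exact: orbit0_0 | exact: orbit0_theta]. Qed.

(* The graph of the action of [g].  Off the orbit of 0 the flag of a point is
   [true] by convention, so flags are compared on the orbit only. *)
Definition mirror (g : gen) u v :=
  (exists z : int, (X_val u).1 + (X_val v).1 = pivot g + z%:~R) /\
  (orbit0 theta (X_val u).1 -> (X_val v).2 = ~~ (X_val u).2).

Lemma orbit0_pivotB g x (z : int) :
  orbit0 theta x -> orbit0 theta (pivot g + z%:~R - x).
Proof.
move=> o; apply: orbit0B => //; apply: orbit0D; last exact: orbit0_int.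
exact: orbit0_pivot.
Qed.

Lemma mirror_orbit g u v : mirror g u v ->
  orbit0 theta (X_val u).1 -> orbit0 theta (X_val v).1.
Proof. by move=> [[z e] _] /(orbit0_pivotB g z); rewrite -e addrAC subrr add0r. Qed.

Lemma mirror_sym g u v : mirror g u v -> mirror g v u.
Proof.
move=> m; have [[z e] s] := m; split; first by exists z; rewrite addrC.
move=> /(orbit0_pivotB g z); rewrite -e addrK => /s ->.
by rewrite negbK.
Qed.

Lemma mirror_inj g u v w : mirror g u v -> mirror g u w -> v = w.
Proof.
move=> m m'; have [[y e] s] := m; have [[z e'] s'] := m'.
apply: (@X_eq_mod _ _ (y - z)); first by rewrite intrB; lra.
by move=> /(mirror_orbit (mirror_sym m)) o; rewrite s ?s'.
Qed.

Lemma orbit0_frac x : orbit0 theta (Defs.frac x) <-> orbit0 theta x.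
Proof.
split=> h; last by apply: orbit0B => //; exact: orbit0_int.
rewrite -(subrK (Num.floor x)%:~R x).
by apply: orbit0D => //; exact: orbit0_int.
Qed.

Lemma reflectionE g x :
  exists z : int, reflection theta g x = pivot g + z%:~R - x.
Proof. by case: g; [exists 1 | exists 0]; rewrite /= ?add0r ?addr0. Qed.

Lemma mirror_act g u : mirror g u (X_act u g).
Proof.
rewrite /X_act /Defs.cut /mirror /=; set x := (X_val u).1.
have [y ->] := reflectionE g x; set r := pivot g + _ - x.
split.
  (* The left copy of 0 is written (1, false) by [cut], which shifts the integer by one. *)
  case: ifP => [/andP[/eqP f0 _]|_] /=.
    exists (y + 1 - Num.floor r).
    by rewrite intrB intrD; move: f0; rewrite /Defs.frac /r; lra.
  by exists (y - Num.floor r); rewrite intrB /Defs.frac /r; lra.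
move=> /(orbit0_pivotB g y) o; case: ifP => [/andP[_ /negbTE]//|_] /=.
by have /orbit0_frac/mem_set -> := o; rewrite orbF.
Qed.

Lemma mirrorE g u v : mirror g u v -> X_act u g = v.
Proof. exact/mirror_inj/mirror_act. Qed.

Lemma X_actK g : involutive (fun u => X_act u g).
Proof. by move=> u; apply/mirrorE/mirror_sym/mirror_act. Qed.

(** The interval from l + 0 to r - 0 in coordinates, for arbitrary pairs and not only for points of
    [X_space]. *)
Definition between (l r : R) (u : R * bool) : Prop :=
  (l < u.1 \/ l = u.1 /\ u.2 = true) /\ (u.1 < r \/ u.1 = r /\ u.2 = false).

Lemma X_ltP u v : reflect ((X_val u).1 < (X_val v).1 \/
  [/\ (X_val u).1 = (X_val v).1, (X_val u).2 = false & (X_val v).2 = true])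
  (u < v)%O.
Proof.
rewrite -lt_val Order.ProdLexiOrder.ltEprodlexi /=.
case: (X_val u) (X_val v) => [x s] [y t] /=.
case: (ltgtP x y) => [xy|xy|->] /=.
- by constructor; left.
- by constructor; case=> [|[]]; lra.
- by case: s t => -[]; constructor; try (by right); case=> [|[]]//; rewrite ltxx.
Qed.

(** The end q is taken in the orbit so that [cut theta q false] keeps the flag [false]; for q = 1
    the special case of [cut] gives 1 - 0. *)
Lemma X_itvE p q u : 0 <= p < 1 -> 0 < q <= 1 -> orbit0 theta q ->
  X_itv theta p q u <-> between p q (X_val u).
Proof.
move=> /andP[p0 p1] /andP[q0 q1] oq.
have fp : Defs.frac p = p.
  by rewrite /Defs.frac (@floor_def _ _ 0) ?subr0 // add0r p0.
have cp : X_val (Defs.cut theta p true) = (p, true) by rewrite /= fp andbF.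
have cq : X_val (Defs.cut theta q false) = (q, false).
  rewrite /=; have [->|qN1] := eqVneq q 1.
    by rewrite /Defs.frac floor1 subrr eqxx.
  have -> : Defs.frac q = q.
    rewrite /Defs.frac (@floor_def _ _ 0) ?subr0 // add0r (ltW q0) /=.
    by rewrite lt_neqAle qN1.
  by rewrite (mem_set oq) gt_eqF.
rewrite /X_itv; move: cp cq.
move: (Defs.cut theta p true) (Defs.cut theta q false) => a b ap bq.
rewrite /= in_itv /= !leNgt.
have -> : (~~ (u < a)%O && ~~ (b < u)%O) = (~ (u < a)%O /\ ~ (b < u)%O) :> Prop.
  by apply/propext; split => [/andP[/negP ? /negP]|[/negP -> /negP]].
move: (X_ltP u a) (X_ltP b u); rewrite /between ap bq /=.
case: (X_val u) => x s /=.
move=> /rwP P /rwP Q; rewrite -P -Q => {P Q}.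
split => [[A B]|[A B]]; split.
- case: (ltgtP p x) A => [|?|e] A; [by left|by case: A; left|right].
  by split=> //; apply: contra_notT A => /negbTE ->; right.
- case: (ltgtP x q) B => [|?|e] B; [by left|by case: B; left|right].
  by split=> //; apply: contra_notF B => ->; right.
- by move=> [|[e]]; case: A => [|[]]; try lra; move=> _ ->.
- by move=> [|[e]]; case: B => [|[]]; try lra; move=> _ ->.
Qed.

End Points.

(** * Floors and rescaling *)

Section Between.
Variable R : realType.
Implicit Types (a d l r : R) (u v : R * bool).

(** Flags matter only where a coordinate meets an end, so they are compared only there; off the
    orbit they carry no information. *)
Lemma between_scale a d l r u v : 0 < d -> v.1 = a + d * u.1 ->
  (u.1 = l \/ u.1 = r -> v.2 = u.2) ->
  between l r u <-> between (a + d * l) (a + d * r) v.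
Proof.
move=> d0 e s; rewrite /between e !ltrD2l !ltr_pM2l //.
have i x y : a + d * x = a + d * y <-> x = y.
  by split=> [/addrI/mulfI->|->]//; rewrite gt_eqF.
rewrite !i; split=> -[A B]; split.
- by case: A => [|[e1 e2]]; [left|right; rewrite s ?e2//; left].
- by case: B => [|[e1 e2]]; [left|right; rewrite s ?e2//; right].
- by case: A => [|[e1 e2]]; [left|right; rewrite -s ?e2//; left].
- by case: B => [|[e1 e2]]; [left|right; rewrite -s ?e2//; right].
Qed.

Lemma between_flip a d l r u v : 0 < d -> v.1 = a - d * u.1 ->
  (u.1 = l \/ u.1 = r -> v.2 = ~~ u.2) ->
  between l r u <-> between (a - d * r) (a - d * l) v.
Proof.
move=> d0 e s; rewrite /between e !ltrD2l !ltrN2 !ltr_pM2l //.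
have i x y : a - d * x = a - d * y <-> x = y.
  by split=> [/addrI/oppr_inj/mulfI->|->]//; rewrite gt_eqF.
rewrite !i; split=> -[A B]; split.
- by case: B => [|[e1 e2]]; [left|right; rewrite s ?e2//; right].
- by case: A => [|[e1 e2]]; [left|right; rewrite s ?e2//; left].
- case: B => [|[e1 e2]]; [by left|right; split=> //].
  by rewrite -[u.2]negbK -s ?e2 //; left.
- case: A => [|[e1 e2]]; [by left|right; split=> //].
  by rewrite -[u.2]negbK -s ?e2 //; right.
Qed.

(** The base of index k of A_0 runs from [lo x k] to [hi x k]; every k > 0 stands for 1. *)
Definition lo (x : R) (k : nat) : R := if k is 0 then 0 else x.
Definition hi (x : R) (k : nat) : R := if k is 0 then x else 1.

Definition in_base (x : R) (k : nat) u := between (lo x k) (hi x k) u.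

Lemma in_base_total x u : 0 <= u.1 <= 1 -> (u.1 = 0 -> u.2 = true) ->
  (u.1 = 1 -> u.2 = false) -> in_base x 0 u \/ in_base x 1 u.
Proof.
move=> /andP[u0 u1] h0 h1; rewrite /in_base /between /=.
case: (ltgtP u.1 x) => [ux|ux|e].
- left; split; last by left.
  move: u0; rewrite le_eqVlt => /orP[/eqP e|]; last by left.
  by right; rewrite h0.
- right; split; first by left.
  move: u1; rewrite le_eqVlt => /orP[/eqP e|]; last by left.
  by right; rewrite h1.
- case E : u.2; [right|left]; split; try by right.
  + move: u1; rewrite le_eqVlt => /orP[/eqP e1|]; last by left.
    by right; rewrite -E h1.
  + move: u0; rewrite le_eqVlt => /orP[/eqP e1|]; last by left.
    by right; rewrite -E h0.
Qed.

Lemma in_base_uniq x k k' u : (k <= 1)%N -> (k' <= 1)%N ->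
  in_base x k u -> in_base x k' u -> k = k'.
Proof.
rewrite /in_base /between.
by case: k k' => [|[]] // [|[]] //= _ _ [A B] [C D]; exfalso;
  case: A B C D => [?|[? e]] [?|[? e2]] [?|[? e3]] [?|[? e4]];
  (lra || congruence).
Qed.

End Between.

Lemma int_le2 (z : int) : 0 <= z <= 2 -> z = 0 \/ z = 1 \/ z = 2.
Proof. by lia. Qed.

(** * One step of the coding: a floor and a rescaled point *)

Section Step.
Variables (R : realType) (theta theta' : R).
Hypothesis h : 0 < theta < 1.
Hypothesis h' : 0 < theta' < 1.
Hypothesis hE : ((cf theta)%:R + theta') * theta = 1.
Local Notation c := (cf theta).
Implicit Types (u v : X_space theta) (w x : X_space theta') (i j k r : nat).

Let theta_gt0 : 0 < theta. Proof. by case/andP: h. Qed.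

Lemma orbit0_lo (x : R) k : orbit0 x (lo x k).
Proof. by case: k => [|k]; [exact: orbit0_0 | exact: orbit0_theta]. Qed.

Lemma orbit0_hi (x : R) k : orbit0 x (hi x k).
Proof. by case: k => [|k]; [exact: orbit0_theta | exact: orbit0_1]. Qed.

Lemma one_subM (x : R) : 1 - x * theta = (c%:R + theta' - x) * theta.
Proof. by rewrite mulrBl hE. Qed.

(** Division by theta is multiplication by c + theta' and turns m theta + n into n theta' + (m + n
    c): the coefficient of theta' is the old constant term. *)
Lemma orbit0_scale j (x : R) :
  orbit0 theta ((j%:R + x) * theta) <-> orbit0 theta' x.
Proof.
split=> -[m [n e]].
  exists n, (m + n * c%:Z - j%:Z); rewrite intrB intrD intrM -!pmulrn.
  have := congr1 (fun z => (c%:R + theta') * z) e.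
  rewrite [X in X = _](_ : _ = (j%:R + x) * ((c%:R + theta') * theta)); last ring.
  rewrite [X in _ = X](_ : _ = m%:~R * ((c%:R + theta') * theta) +
    n%:~R * (c%:R + theta')); last ring.
  by rewrite hE; lra.
exists (n + j%:Z - m * c%:Z), m; rewrite intrB intrD intrM -!pmulrn e.
have -> : (j%:R + (m%:~R * theta' + n%:~R)) * theta =
   (n%:~R + j%:R - m%:~R * c%:R) * theta + m%:~R * ((c%:R + theta') * theta).
  ring.
by rewrite hE mulr1.
Qed.

(** The map x |-> theta' + k - x exchanges the ends of the base of index k. So b preserves each
    base, and there the integer in [mirror] is k. *)
Lemma mirror_base w x k : (k <= 1)%N -> in_base theta' k (X_val w) ->
  mirror Gb w x ->
  (X_val w).1 + (X_val x).1 = theta' + k%:R /\ in_base theta' k (X_val x).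
Proof.
move=> k1 b m; have [/andP[w0 w1] wl wr _] := X_valP w.
have /andP[t0 t1] := h'.
have [y [ey sy]] : exists y : X_space theta',
    (X_val y).1 = theta' + k%:R - (X_val w).1 /\
    (orbit0 theta' (theta' + k%:R - (X_val w).1) -> (X_val y).2 = ~~ (X_val w).2).
  move: b; rewrite /in_base /between.
  case: k k1 => [|[]] //= _ [A B]; apply: X_exists; rewrite ?mulr0n ?mulr1n.
  - by case: A B => [?|[? e]] [?|[? e2]]; lra.
  - by case: B => [?|[? ->]] //= ?; lra.
  - by move=> ?; lra.
  - by case: A B => [?|[? e]] [?|[? e2]]; lra.
  - by move=> ?; lra.
  - by case: A => [?|[? ->]] //= ?; lra.
have m' : mirror Gb w y.
  split; first by exists k%:Z; rewrite ey /= -pmulrn; lra.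
  by move=> /(orbit0_pivotB Gb k%:Z) /= o; rewrite sy // pmulrn.
rewrite (mirror_inj m m') ey; split; first lra.
have o : orbit0 theta' (X_val w).1 -> (X_val y).2 = ~~ (X_val w).2 by case: m'.
have := @between_flip _ (theta' + k%:R) 1 (lo theta' k) (hi theta' k)
  (X_val w) (X_val y) ltr01.
rewrite !mul1r => /(_ ey) H.
have e1 : theta' + k%:R - hi theta' k = lo theta' k.
  by case: k k1 {b m ey sy H} => [|[]] //= _; rewrite ?mulr0n ?mulr1n; lra.
have e2 : theta' + k%:R - lo theta' k = hi theta' k.
  by case: k k1 {b m ey sy H e1} => [|[]] //= _; rewrite ?mulr0n ?mulr1n; lra.
rewrite e1 e2 in H; apply/H => // hw; apply: o.
by case: hw => ->; [exact: orbit0_lo | exact: orbit0_hi].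
Qed.

(* u lies in the floor of tower k which is the i-th from the left, and w is the
   rescaled point of the base of which u is a translate. *)
Definition cell u i k w :=
  [/\ (k <= 1)%N, (i + k <= c)%N, in_base theta' k (X_val w),
      (X_val u).1 = (i%:R + (X_val w).1) * theta
    & orbit0 theta (X_val u).1 -> (X_val u).2 = (X_val w).2].

Lemma cell_exists u : exists i k w, cell u i k w.
Proof.
have [/andP[u0 u1] ul ur _] := X_valP u.
pose z := (X_val u).1 * (c%:R + theta').
have ez : (X_val u).1 = z * theta by rewrite /z -mulrA hE mulr1.
have z0 : 0 <= z by rewrite /z mulr_ge0 //; case/andP: h' => *; rewrite addr_ge0 // ltW.
have zc : z <= c%:R + theta'.
  by rewrite -(ler_pM2r theta_gt0) -ez hE.
(* The index i is the integer part of z, lowered by one when u is the left copy of an integer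
   multiple of theta. *)
have [i [iz zi il ir]] : exists i, [/\ i%:R <= z, z <= i.+1%:R,
    z = i%:R -> (X_val u).2 = true & z = i.+1%:R -> (X_val u).2 = false].
  have /andP[t0 t1] := truncn_itv z0.
  case s : (X_val u).2.
    by exists (Num.truncn z); split => //; [exact: ltW | lra].
  move: t0; rewrite le_eqVlt => /orP[/eqP t0|t0]; last first.
    by exists (Num.truncn z); split => //; [exact: ltW | exact: ltW | lra].
  case: (Num.truncn z) t0 {t1} => [|n] t0.
    by have := ul; rewrite s ez -t0 mul0r => /(_ erefl).
  exists n; split => //; rewrite -?t0 ?ler_nat //.
  by move=> /eqP; rewrite eqr_nat; lia.
have [w [ew sw]] : exists w, (X_val w).1 = z - i%:R /\
    (orbit0 theta' (z - i%:R) -> (X_val w).2 = (X_val u).2).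
  rewrite -natr1 in zi ir; apply: X_exists; first by apply/andP; split; lra.
  - by move=> ?; apply: il; lra.
  - by move=> ?; apply: ir; lra.
have ezw : z = i%:R + (X_val w).1 by lra.
have [w01 wl wr _] := X_valP w.
have uw : orbit0 theta (X_val u).1 -> (X_val u).2 = (X_val w).2.
  rewrite ez ezw => /orbit0_scale; rewrite ew => o.
  by rewrite sw.
have [/andP[t'0 t'1]] := h'.
have [b|b] := in_base_total theta' w01 wl wr.
  exists i, 0%N, w; split=> //; last by rewrite ez ezw.
  rewrite addn0 -ltnS -(ltr_nat R) -natr1; lra.
exists i, 1%N, w; split=> //; last by rewrite ez ezw.
(* If c <= i, then w > theta' contradicts z <= c + theta', and w = theta' + 0 would give u = 1 with
   the flag [true]. *)
rewrite addn1 ltnNge -(ler_nat R); apply/negP => ci.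
case: b => -[A|[A B]] _; rewrite /= in A; first by lra.
have e1 : (X_val u).1 = 1 by rewrite -hE ez; congr (_ * _); lra.
by have := uw; rewrite e1 ur // B => /(_ (orbit0_1 _)).
Qed.

Lemma cell_uniq u i k w i' k' w' : cell u i k w -> cell u i' k' w' ->
  [/\ i = i', k = k' & w = w'].
Proof.
move=> [k1 _ b e s] [k1' _ b' e' s'].
have E : i%:R + (X_val w).1 = i'%:R + (X_val w').1.
  by apply: (mulIf (lt0r_neq0 theta_gt0)); rewrite -e -e'.
have ww : w = w'.
  apply: (@X_eq_mod _ _ _ _ (i'%:Z - i%:Z)).
    by rewrite intrB -!pmulrn; lra.
  by move=> /(orbit0_scale i); rewrite -e => o; rewrite -s ?s'.
split=> //; last by apply: in_base_uniq b _; rewrite ?ww.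
by move: E; rewrite ww => /addIr/eqP; rewrite eqr_nat => /eqP.
Qed.

(* [step u k r w]: u lies in the floor of rank r of tower k, and w is the
   rescaled point of the base from which r reflections lead to u. *)
Definition step u k r w :=
  let y := ((r./2)%:R + (X_val w).1) * theta in
  [/\ (k <= 1)%N, (r + k <= c)%N, in_base theta' k (X_val w),
      (X_val u).1 = (if odd r then 1 - y else y)
    & orbit0 theta (X_val u).1 -> (X_val u).2 = odd r (+) (X_val w).2].

Lemma orbit0_step u k r w : step u k r w ->
  orbit0 theta (X_val u).1 <-> orbit0 theta' (X_val w).1.
Proof.
case=> _ _ _ -> _; rewrite -(orbit0_scale r./2); case: odd => //.
split; last exact/orbit0B/orbit0_1.
by move=> /(orbit0B (orbit0_1 _)); rewrite opprB addrC subrK.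
Qed.

Lemma natr_odd_half r : r%:R = (odd r)%:R + 2 * (r./2)%:R :> R.
Proof. by rewrite -[in LHS](odd_double_half r) natrD -muln2 natrM mulrC. Qed.

(** With r = 2j + 1, 1 - (j + w) theta = (c - k - j + (theta' + k - w)) theta: the index from the
    left is c - k - j, and w is replaced by its image under b. *)
Lemma step_cell u k r w : step u k r w ->
  cell u (if odd r then c - k - r./2 else r./2)%N k
    (if odd r then X_act w Gb else w).
Proof.
move=> st; have := st; case=> k1 rk b e s; have os := orbit0_step st.
have r2 := odd_double_half r; case: ifP e s => odr e s; last first.
  by split=> //; lia.
have [ex bx] := mirror_base k1 b (mirror_act Gb w).
split=> //; first by lia.
  have kc : (k <= c)%N by lia.
  have jk : (r./2 <= c - k)%N by lia.
  rewrite !natrB // e one_subM; congr (_ * _); lra.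
move=> o; rewrite s //; have [_ ->] := mirror_act Gb w; last exact/os.
by rewrite addTb.
Qed.

(** The left half of a tower has the even ranks 2i; the right half, counted from the right, has the
    odd ranks 2(c - k - i) + 1. *)
Lemma cell_step u i k w : cell u i k w -> exists r x, step u k r x.
Proof.
case=> k1 ik b e s; have [cs|cs] := leqP (i.*2 + k) c.
  exists i.*2, w; split=> //; rewrite odd_double ?doubleK //.
have [ex bx] := mirror_base k1 b (mirror_act Gb w).
exists (c - k - i).*2.+1, (X_act w Gb); split=> //.
- by lia.
- have kc : (k <= c)%N by lia.
  have ick : (i <= c - k)%N by lia.
  rewrite /= odd_double /= uphalf_double e !natrB //.
  by rewrite one_subM; congr (_ * _); lra.
- move=> o; rewrite s // /= odd_double /=.
  have [_ ->] := mirror_act Gb w; first by rewrite negbK.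
  by move: o; rewrite e => /orbit0_scale.
Qed.

Lemma step_exists u : exists k r w, step u k r w.
Proof.
have [i [k [w /cell_step [r [x st]]]]] := cell_exists u.
by exists k, r, x.
Qed.

Lemma step_uniq u k r w k' r' w' : step u k r w -> step u k' r' w' ->
  [/\ k = k', r = r' & w = w'].
Proof.
move=> s s'; have [ei ek ew] := cell_uniq (step_cell s) (step_cell s').
case: s s' => k1 rk _ _ _ [_ rk' _ _ _].
have r2 := odd_double_half r; have r2' := odd_double_half r'.
have er : r = r' by move: ei; case: (odd r) r2; case: (odd r') r2' => /=; lia.
split=> //; move: ew; rewrite er; case: odd => //.
exact: (can_inj (X_actK Gb)).
Qed.

Lemma in_base_hi w k : in_base theta' k (X_val w) -> (k <= 1)%N ->
  (X_val w).1 <= theta' + k%:R.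
Proof.
have [/andP[_ w1] _ _ _] := X_valP w; have /andP[t0 t1] := h'.
by case: k => [|[]] //= [_ [B|[B _]]] _; rewrite /= in B;
  rewrite ?mulr0n ?mulr1n; lra.
Qed.

Lemma step_point k r w : (k <= 1)%N -> (r + k <= c)%N ->
  in_base theta' k (X_val w) -> exists u, step u k r w.
Proof.
move=> k1 rk b; pose y := ((r./2)%:R + (X_val w).1) * theta.
have [/andP[w0 w1] wl wr _] := X_valP w.
have r2 := odd_double_half r.
have jk : (r./2)%:R + k%:R <= c%:R :> R by rewrite -natrD ler_nat; lia.
have hw := in_base_hi b k1; have /andP[t0 t1] := h'.
have y0 : 0 <= y by rewrite mulr_ge0 ?addr_ge0 // ltW.
have y1 : y <= 1 by rewrite -hE ler_pM2r //; lra.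
have yl : y = 0 -> (X_val w).2 = true.
  move=> /eqP; rewrite mulf_eq0 (gt_eqF theta_gt0) orbF => /eqP e.
  by apply: wl; have : 0 <= (r./2)%:R :> R by []; lra.
have yr : y = 1 -> (X_val w).2 = false.
  rewrite -hE => /(mulIf (lt0r_neq0 theta_gt0)) e.
  have ew : (X_val w).1 = theta' + k%:R by lra.
  case: b => _ [|[_ //]]; move: ew; case: (k) k1 => [|[]] //= _;
    rewrite ?mulr0n ?mulr1n; lra.
have [u [eu su]] : exists u, (X_val u).1 = (if odd r then 1 - y else y) /\
    (orbit0 theta (if odd r then 1 - y else y) ->
     (X_val u).2 = odd r (+) (X_val w).2).
  apply: X_exists; case: odd => /=.
  - by apply/andP; split; lra.
  - by rewrite y0.
  - by move=> ?; rewrite yr //; lra.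
  - exact: yl.
  - by move=> ?; rewrite yl //; lra.
  - exact: yr.
by exists u; split=> //; rewrite eu.
Qed.

(** The coordinate reached from x theta in the base by the r reflections a, b, a, ...; it is
    decreasing in x when r is odd. *)
Definition place r (x : R) : R :=
  let y := ((r./2)%:R + x) * theta in if odd r then 1 - y else y.

Lemma step_between u k r w a b : step u k r w ->
  orbit0 theta' a -> orbit0 theta' b ->
  between a b (X_val w) <->
  if odd r then between (place r b) (place r a) (X_val u)
  else between (place r a) (place r b) (X_val u).
Proof.
move=> st oa ob; have os := orbit0_step st; case: st => _ _ _ e s.
have ow : (X_val w).1 = a \/ (X_val w).1 = b -> orbit0 theta (X_val u).1.
  by move=> H; apply/os; case: H => ->.
have D (x : R) : ((r./2)%:R + x) * theta = (r./2)%:R * theta + theta * x by ring.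
rewrite /place; move: e s; rewrite !D; case: odd => /= e s.
  rewrite !opprD !addrA; apply: between_flip => //; first by rewrite e; ring.
  by move=> /ow/s.
by apply: between_scale => // /ow/s.
Qed.

Lemma between_sub (a b a' b' : R) (p : R * bool) : a' <= a -> b <= b' ->
  between a b p -> between a' b' p.
Proof.
move=> aa bb [A B]; split.
- move: aa; rewrite le_eqVlt => /orP[/eqP->//|aa]; left.
  by case: A => [|[]]; lra.
- move: bb; rewrite le_eqVlt => /orP[/eqP<-//|bb]; left.
  by case: B => [|[]]; lra.
Qed.

(** Rank 0 stays in [0, theta], and every other floor lies in [theta, 1]. The boolean [r != 0]
    serves as the index of the base, and hence as the source of the edge. *)
Lemma place_base k r (x : R) : (k <= 1)%N -> (r + k <= c)%N ->
  lo theta' k <= x <= hi theta' k ->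
  lo theta (r != 0)%N <= place r x <= hi theta (r != 0)%N.
Proof.
move=> k1 rk /andP[xl xr]; have r2 := odd_double_half r.
have /andP[t0 t1] := h'.
have x0 : 0 <= x by apply: le_trans xl; case: (k) => //= _; exact: ltW.
have x1 : x <= 1 by apply: (le_trans xr); case: (k) => //=; exact: ltW.
rewrite /place; case odr : (odd r) r2 => /= r2.
  have -> /= : (r != 0)%N by lia.
  rewrite one_subM -[X in X <= _]mul1r ler_pM2r //.
  rewrite -[X in _ && (_ <= X)]hE ler_pM2r //.
  have j0 : 0 <= (r./2)%:R :> R by [].
  apply/andP; split; last by lra.
  case: k k1 rk xl xr => [|[]] //= _ rk xl xr.
    have : (r./2).+1%:R <= c%:R :> R by rewrite ler_nat; lia.
    by rewrite -natr1; lra.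
  have : (r./2).+2%:R <= c%:R :> R by rewrite ler_nat; lia.
  by rewrite -addn2 natrD; lra.
have [r0|r0] := eqVneq r 0%N.
  rewrite r0 /= add0r mulr_ge0 ?(ltW theta_gt0) //=.
  by rewrite -[X in _ <= X]mul1r ler_pM2r.
rewrite /= -[X in X <= _]mul1r ler_pM2r //.
rewrite -[X in _ && (_ <= X)]hE ler_pM2r //.
have : 1 <= (r./2)%:R :> R by rewrite ler1n; lia.
have : (r./2)%:R + k%:R <= c%:R :> R by rewrite -natrD ler_nat; lia.
have : x <= theta' + k%:R.
  by case: (k) xr => [|n] /=; rewrite ?mulr0n ?addr0 // -natr1;
    have : 0 <= n%:R :> R by []; lra.
by move=> *; apply/andP; split; lra.
Qed.

Lemma step_base u k r w : step u k r w -> in_base theta (r != 0)%N (X_val u).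
Proof.
move=> st; have := step_between st (orbit0_lo _ k) (orbit0_hi _ k).
case: st => k1 rk b _ _ [/(_ b) + _].
have le_lh : lo theta' k <= hi theta' k.
  by case: (k) => [|n] /=; case/andP: h' => *; exact: ltW.
have /andP[l1 l2] : lo theta (r != 0)%N <= place r (lo theta' k) <= hi theta (r != 0)%N.
  by apply: (place_base k1 rk); rewrite lexx.
have /andP[h1 h2] : lo theta (r != 0)%N <= place r (hi theta' k) <= hi theta (r != 0)%N.
  by apply: (place_base k1 rk); rewrite lexx andbT.
by case: odd; exact: between_sub.
Qed.

(** Rule (i): the two coordinates add up to 1 for even r, which is a, and to theta + 1 for odd r,
    which is b. *)
Lemma step_neighbors u v k r w : step u k r w -> step v k r.+1 w ->
  mirror (step_gen r) u v.
Proof.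
move=> st st'; have os := orbit0_step st; have os' := orbit0_step st'.
case: st st' => _ _ _ e s [_ _ _ e' s'].
split; last first.
  move=> o; have o' : orbit0 theta (X_val v).1 by apply/os'/os.
  by rewrite s' // s //=; case: odd; rewrite //= negbK.
exists 1; rewrite e e' /= uphalf_half /step_gen /pivot.
by case: odd => /=; rewrite ?natrD ?add0n; ring.
Qed.

(** Rule (iii): since w + x = theta' + k and r + k = c, the relation (c + theta') theta = 1 makes
    the coordinates add up to 1 for even r and to theta + 1 for odd r. *)
Lemma step_last u v k r w x : step u k r w -> (r + k = c)%N ->
  mirror Gb w x -> step v k r x -> mirror (step_gen r) u v.
Proof.
move=> st rk m st'; have os := orbit0_step st; have os' := orbit0_step st'.
case: st st' => k1 _ b e s [_ _ _ e' s'].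
have [ex _] := mirror_base k1 b m.
split; last first.
  move=> o; have o' := (os.1 o); have [_ mw] := m.
  rewrite s' ?s //; first by rewrite mw //; case: odd; rewrite //= negbK.
  exact/os'/(mirror_orbit m).
have ext := congr1 (fun z => z * theta) ex.
have E1 : c%:R = r%:R + k%:R :> R by rewrite -natrD rk.
have hE2 := hE; rewrite E1 natr_odd_half in hE2.
exists 1; rewrite e e' /step_gen /pivot; case: odd hE2 => /= hE2; lra.
Qed.

(** Rule (ii): w + x = 1 rescales to a sum of theta, which is the reflection b. *)
Lemma step_first u v k k' w x : step u k 0 w -> mirror Ga w x ->
  step v k' 0 x -> mirror Gb u v.
Proof.
move=> st m st'; have os := orbit0_step st; have os' := orbit0_step st'.
case: st st' => _ _ _ e s [_ _ _ e' s']; have [[z ez] mw] := m.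
split; last first.
  move=> o; have o' := (os.1 o).
  by rewrite s' ?s ?mw //; exact/os'/(mirror_orbit m).
exists 0; rewrite e e' /= !add0r addr0 -mulrDl.
suff -> : (X_val w).1 + (X_val x).1 = 1 by rewrite mul1r.
have [/andP[w0 w1] wl wr _] := X_valP w.
have [/andP[x0 x1] xl xr _] := X_valP x.
rewrite /= add0r in ez.
(* For z = 0 or z = 2 both w and x would be 0, or both 1, with equal flags, whereas a reverses the
   flag. *)
have : (0 <= z <= 2)%R by rewrite -!(ler_int R); apply/andP; split; lra.
case/int_le2 => [z0|[z1|z2]].
- rewrite z0 in ez; have ew : (X_val w).1 = 0 by lra.
  by move: mw; rewrite ew wl // xl; [move=> /(_ (orbit0_0 _))|lra].
- by rewrite ez z1.
- rewrite z2 in ez; have ew : (X_val w).1 = 1 by lra.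
  by move: mw; rewrite ew wr // xr; [move=> /(_ (orbit0_1 _))|lra].
Qed.

End Step.

Lemma half_leq_self n : (n./2 <= n)%N.
Proof. by lia. Qed.

Lemma half_le_pred (n m : nat) :
  (n + 1 <= m)%N -> (1 <= m)%N /\ (n./2 <= m - 1)%N.
Proof. by lia. Qed.

(** * Floors as pairs of a tower and a rank *)

Section FloorIndices.
Variable c : nat.
Implicit Types e : floors c.

Lemma rank_tower e : (rank e + tower e <= c)%N.
Proof. by case: e => k r; rewrite /rank /tower /=; have := ltn_ord r; lia. Qed.

Lemma tower_le1 e : (tower e <= 1)%N.
Proof. by rewrite -ltnS ltn_ord. Qed.

Lemma floors_eq e e' : tower e = tower e' -> rank e = rank e' -> e = e'.
Proof.
case: e e' => k r [k' r']; rewrite /tower /rank /= => ek.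
by rewrite ek in r *; move=> /val_inj ->.
Qed.

Lemma floors_exists (k : 'I_2) (r : nat) : (r + k <= c)%N ->
  exists e : floors c, tower e = k /\ rank e = r.
Proof.
move=> rk; have rk' : (r < c.+1 - k)%N by have := ltn_ord k; lia.
by exists (existT _ k (Ordinal rk')).
Qed.

End FloorIndices.

(** * Floors as subsets of the space, and the sources of edges *)

Section Floors.
Variables (R : realType) (theta theta' : R).
Hypothesis h : 0 < theta < 1.
Hypothesis h' : 0 < theta' < 1.
Hypothesis hE : ((cf theta)%:R + theta') * theta = 1.
Local Notation c := (cf theta).
Local Notation step := (@step R theta theta').
Implicit Types (u v : X_space theta) (w x : X_space theta') (i j k r : nat).
Implicit Types e : floors c.

Let theta_gt0 : 0 < theta. Proof. by case/andP: h. Qed.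

Lemma lo_lt_hi k : lo theta' k < hi theta' k.
Proof. by case: k => [|k] /=; case/andP: h'. Qed.

Lemma lo_ge0 k : 0 <= lo theta' k.
Proof. by case: k => [|k] //=; case/andP: h' => /ltW. Qed.

Lemma hi_le1 k : hi theta' k <= 1.
Proof. by case: k => [|k] //=; case/andP: h' => _ /ltW. Qed.

Definition in_floor k r u :=
  let a := place theta r (lo theta' k) in
  let b := place theta r (hi theta' k) in
  if odd r then between b a (X_val u) else between a b (X_val u).

Lemma step_in_floor u k r w : step u k r w -> in_floor k r u.
Proof.
move=> st; have := step_between h hE st (orbit0_lo _ k) (orbit0_hi _ k).
by case: st => _ _ b _ _ [/(_ b)].
Qed.

Lemma in_floor_step u k r : (k <= 1)%N -> (r + k <= c)%N ->
  in_floor k r u -> exists w, step u k r w.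
Proof.
(* This x solves u = [place theta r x], since c + theta' is the inverse of theta. *)
move=> k1 rk; pose x := (if odd r then 1 - (X_val u).1 else (X_val u).1)
  * (c%:R + theta') - (r./2)%:R.
have ux : (X_val u).1 = place theta r x.
  rewrite /place /x addrCA subrr addr0 -mulrA hE mulr1.
  by case: odd => //; rewrite opprB addrC subrK.
pose s := odd r (+) (X_val u).2 => fu.
have b : between (lo theta' k) (hi theta' k) (x, s).
  have D (y : R) : ((r./2)%:R + y) * theta = (r./2)%:R * theta + theta * y by ring.
  move: fu ux; rewrite /in_floor /place /s !D; case: odd => /= fu ux.
    move: fu; rewrite !opprD !addrA => fu.
    by apply: (between_flip theta_gt0 _ _).2 fu; rewrite /= ?negbK // ux; ring.
  by apply: (between_scale theta_gt0 _ _).2 fu.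
have l0 := lo_ge0 k; have h1 := hi_le1 k.
have [w [ew sw]] : exists w, (X_val w).1 = x /\ (orbit0 theta' x -> (X_val w).2 = s).
  apply: X_exists.
  - by case: b => [[A|[A _]] [B|[B _]]]; rewrite /= in A B; apply/andP; split; lra.
  - by move=> x0; case: b => [[A|[_ //]] _]; rewrite /= in A; lra.
  - by move=> x0; case: b => [_ [A|[_ //]]]; rewrite /= in A; lra.
have ow : orbit0 theta (X_val u).1 -> orbit0 theta' x.
  rewrite ux /place -(orbit0_scale hE r./2); case: odd => //.
  by move=> /(orbit0B (orbit0_1 _)); rewrite opprB addrC subrK.
have bw : in_base theta' k (X_val w).
  case: b => /= A B; split; rewrite ew.
    case: A => [|[e1 e2]]; [by left|right; split=> //].
    by rewrite sw // -e1; exact: orbit0_lo.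
  case: B => [|[e1 e2]]; [by left|right; split=> //].
  by rewrite sw // e1; exact: orbit0_hi.
exists w; split=> //; first by rewrite ew.
by move=> /ow o; rewrite sw // /s addKb.
Qed.

Lemma orbit0_place r (x : R) : orbit0 theta' x -> orbit0 theta (place theta r x).
Proof.
move=> /(orbit0_scale hE r./2) o; rewrite /place; case: odd => //.
exact: orbit0B (orbit0_1 _) o.
Qed.

Lemma place_lt r (x y : R) : x < y ->
  if odd r then place theta r y < place theta r x
  else place theta r x < place theta r y.
Proof.
by move=> xy; rewrite /place; case: odd; rewrite ?ltrD2l ?ltrN2 ltr_pM2r // ltrD2l.
Qed.

(** Reconciles the numbering from left to right with the ranks: after 1 = (c + theta') theta is
    used, the ends of the two intervals agree, and for odd rank they are exchanged. *)
Lemma floor_setE e u :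
  Defs.floor_set theta e u <-> in_floor (tower e) (rank e) u.
Proof.
have k1 := tower_le1 e; have rk := rank_tower e.
rewrite /Defs.floor_set /tower_floor /in_floor /itv_index.
move: (tower e) (rank e) k1 rk => k r k1 rk; have lh := lo_lt_hi k.
have /andP[l1 l2] : lo theta (r != 0)%N <= place theta r (lo theta' k)
    <= hi theta (r != 0)%N.
  by apply: (place_base h h' hE k1 rk); rewrite lexx ltW.
have /andP[h1 h2] : lo theta (r != 0)%N <= place theta r (hi theta' k)
    <= hi theta (r != 0)%N.
  by apply: (place_base h h' hE k1 rk); rewrite lexx andbT ltW.
have b0 : 0 <= lo theta (r != 0)%N by case: eqP => //= _; exact: ltW.
have b1 : hi theta (r != 0)%N <= 1.
  by case: eqP => //= _; case/andP: h => _ /ltW.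
have plt := place_lt r lh.
have oh := orbit0_place r (orbit0_hi theta' k).
have ol := orbit0_place r (orbit0_lo theta' k).
have r2 := odd_double_half r.
have -> : (k == ord0) = (k == 0 :> nat)%N by [].
case: (nat_of_ord k) k1 rk l1 l2 h1 h2 oh ol plt =>
  [|[]] //= _ rk l1 l2 h1 h2 oh ol plt; case: ifP plt oh ol => odr plt oh ol.
- have jc : (r./2 <= c)%N.
    by rewrite addn0 in rk; apply: leq_trans rk; exact: half_leq_self.
  rewrite subn0 -X_itvE //; [|by apply/andP; split; lra..].
  rewrite natrB // /place odr (_ : (c%:R - (r./2)%:R) * theta =
    1 - ((r./2)%:R + theta') * theta); last by move: hE; lra.
  by rewrite (_ : 1 - (c%:R - (c%:R - (r./2)%:R)) * theta =
    1 - ((r./2)%:R + 0) * theta); last ring.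
- rewrite -X_itvE //; [|by apply/andP; split; lra..].
  rewrite /place odr addr0 (_ : 1 - (c%:R - (r./2)%:R) * theta =
    ((r./2)%:R + theta') * theta) //; by move: hE; lra.
- have [jc jc'] : (1 <= c)%N /\ (r./2 <= c - 1)%N.
    exact: half_le_pred.
  rewrite -X_itvE //; [|by apply/andP; split; lra..].
  rewrite -natr1 !natrB // /place odr (_ : (c%:R - 1 - (r./2)%:R + 1) * theta =
    1 - ((r./2)%:R + theta') * theta); last by move: hE; lra.
  by rewrite (_ : 1 - (c%:R - (c%:R - 1 - (r./2)%:R)) * theta =
    1 - ((r./2)%:R + 1) * theta); last ring.
- rewrite -X_itvE //; [|by apply/andP; split; lra..].
  rewrite /place odr -natr1 (_ : 1 - (c%:R - (r./2)%:R) * theta =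
    ((r./2)%:R + theta') * theta) //; by move: hE; lra.
Qed.

Lemma base_in_base (j : 'I_2) u : base theta j u <-> in_base theta j (X_val u).
Proof.
have /andP[t0 t1] := h; rewrite /base; case: eqP => [->|j0].
  by rewrite X_itvE ?lexx ?ltr01 ?t0 ?ltW //; exact: orbit0_theta.
have -> : (j : nat) = 1%N.
  by case: j j0 => -[|[|//]] i // []; exact: val_inj.
by rewrite X_itvE ?lexx ?ltr01 ?t1 ?ltW //; exact: orbit0_1.
Qed.

(** By [step_base] the floor lies in the base of index [rank e != 0]. It contains a point and the
    bases are disjoint, so the pick is forced and its default value never occurs. *)
Lemma floor_sourceE e : floor_source theta e = (rank e != 0)%N :> nat.
Proof.
have k1 := tower_le1 e; have rk := rank_tower e.
have sub u : in_floor (tower e) (rank e) u ->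
    in_base theta (rank e != 0)%N (X_val u).
  by move=> /(in_floor_step k1 rk)[w /(step_base h h' hE)].
have [u fu] : exists u, in_floor (tower e) (rank e) u.
  have lh := lo_lt_hi (tower e); have h1 := hi_le1 (tower e).
  have [w [ew sw]] : exists w, (X_val w).1 = lo theta' (tower e) /\
      (orbit0 theta' (lo theta' (tower e)) -> (X_val w).2 = true).
    apply: X_exists => //; first by rewrite lo_ge0 /=; lra.
    by move=> ?; lra.
  have bw : in_base theta' (tower e) (X_val w).
    by split; rewrite ew; [right; rewrite sw //; exact: orbit0_lo|left].
  by have [u /step_in_floor] := step_point h h' hE k1 rk bw; exists u.
have := sub _ fu; rewrite /floor_source; case: pickP => [j /asboolP sj|none] bu.
  apply: in_base_uniq bu; [exact: (ltn_ord j)|by case: eqP|].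
  exact/base_in_base/sj/floor_setE.
have /negP[] := negbT (none (inord (rank e != 0)%N)).
apply/asboolP => v /floor_setE/sub; rewrite base_in_base inordK //.
by case: eqP.
Qed.

End Floors.

(** * Codes *)

Section Codes.
Variable R : realType.
Implicit Types t : nat -> R.

(** Says without division that [t n.+1] is the fractional part of the inverse of [t n]. The
    condition passes to shifted sequences, as inductions along a code require. *)
Definition cf_seq t := forall n,
  0 < t n < 1 /\ ((cf (t n))%:R + t n.+1) * t n = 1.

Lemma cf_seq_shift t : cf_seq t -> cf_seq (seq_shift t).
Proof. by move=> ht n; exact: ht n.+1. Qed.

Definition word t := forall n, floors (cf (t n)).

Definition codes t (u : X_space (t 0%N)) (p : word t) :=
  exists v : forall n, X_space (t n), v 0%N = u /\
    forall n, step (v n) (tower (p n)) (rank (p n)) (v n.+1).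

Definition admissible t (p : word t) :=
  forall n, tower (p n) = floor_source (t n.+1) (p n.+1).

Definition wtail t (p : word t) : word (seq_shift t) := fun n => p n.+1.

Variable t : nat -> R.
Hypothesis ht : cf_seq t.
Implicit Types (p q : word t) (u : X_space (t 0%N)) (w : X_space (t 1%N)).

Let h0 n : 0 < t n < 1. Proof. by case: (ht n). Qed.
Let hE n : ((cf (t n))%:R + t n.+1) * t n = 1. Proof. by case: (ht n). Qed.

Lemma codes_uncons u p : codes u p -> exists w,
  step u (tower (p 0%N)) (rank (p 0%N)) w /\ @codes (seq_shift t) w (wtail p).
Proof.
move=> [v [<- hv]]; exists (v 1%N); split; first exact: hv.
by exists (fun n => v n.+1); split=> // n; exact: hv.
Qed.

Lemma codes_cons u p w : step u (tower (p 0%N)) (rank (p 0%N)) w ->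
  @codes (seq_shift t) w (wtail p) -> codes u p.
Proof.
move=> st [v [v0 hv]].
exists (fun n => if n is m.+1 then v m else u); split=> // -[|n]; last exact: hv.
by rewrite v0.
Qed.

Lemma codes_base u p : codes u p ->
  in_base (t 0%N) (rank (p 0%N) != 0)%N (X_val u).
Proof. by move=> [v [<- /(_ 0%N)/(step_base (h0 _) (h0 _) (hE _))]]. Qed.

Lemma codes_admissible u p : codes u p -> admissible p.
Proof.
move=> [v [_ hv]] n; apply: val_inj => /=.
have := step_base (h0 _) (h0 _) (hE _) (hv n.+1).
rewrite (floor_sourceE (h0 _) (h0 _) (hE _)).
case: (hv n) => k1 _ b _ _; apply: in_base_uniq b => //; by case: eqP.
Qed.

Lemma codes_exists u : exists p, codes u p.
Proof.
have E n (x : X_space (t n)) : {ew : floors (cf (t n)) * X_space (t n.+1) |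
    step x (tower ew.1) (rank ew.1) ew.2}.
  apply: cid; have [k [r [w st]]] := step_exists (h0 _) (h0 _) (hE _) x.
  have [k1 rk _ _ _] := st.
  have [e [ek er]] := @floors_exists _ (@Ordinal 2 k k1) r rk.
  by exists (e, w); rewrite /= ek er.
pose v := nat_rect (fun n => X_space (t n)) u (fun n x => (sval (E n x)).2).
exists (fun n => (sval (E n (v n))).1), v; split=> // n.
exact: (svalP (E n (v n))).
Qed.

Lemma codes_uniq u p q : codes u p -> codes u q -> p = q.
Proof.
move=> [v [<- hv]] [w [w0 hw]]; have vw n : v n = w n.
  elim: n => [//|n IH]; have := hw n; rewrite -IH => st.
  by have [_ _] := step_uniq (h0 _) (h0 _) (hE _) (hv n) st.
apply: functional_extensionality_dep => n; have := hw n; rewrite -vw => st.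
have [/val_inj kk rr _] := step_uniq (h0 _) (h0 _) (hE _) (hv n) st.
exact: floors_eq.
Qed.

End Codes.

(** * A code determines its point *)

Section CodesInjective.
Variable R : realType.
Implicit Types t : nat -> R.

Lemma step_dist (x y : R) (u v : X_space x) k r (w z : X_space y) : 0 < x ->
  step u k r w -> step v k r z ->
  `|(X_val u).1 - (X_val v).1| = x * `|(X_val w).1 - (X_val z).1|.
Proof.
move=> x0 [_ _ _ -> _] [_ _ _ -> _].
transitivity (`|x * ((X_val w).1 - (X_val z).1)|); last first.
  by rewrite normrM gtr0_norm.
case: odd; last by congr (`| _ |); ring.
by rewrite -normrN; congr (`| _ |); ring.
Qed.

Lemma X_dist (x : R) (u v : X_space x) : `|(X_val u).1 - (X_val v).1| <= 1.
Proof.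
have [/andP[u0 u1] _ _ _] := X_valP u; have [/andP[v0 v1] _ _ _] := X_valP v.
by rewrite ler_norml; apply/andP; split; lra.
Qed.

Lemma cf_gt0 t : cf_seq t -> (0 < cf (t 0%N))%N.
Proof.
move=> ht; have [/andP[a b] e] := ht 0%N; have [/andP[c d] _] := ht 1%N.
rewrite lt0n; apply/eqP => c0; rewrite c0 mulr0n add0r in e.
have : t 1%N * t 0%N < 1 by rewrite mulr_ilt1 // ltW.
by lra.
Qed.

(** One step contracts only by [t 0], which may be close to 1. Two steps contract by t 1 t 0 <= 1/2,
    because t 1 t 0 <= t 0 <= c t 0 and c t 0 + t 1 t 0 = 1. *)
Lemma codes_dist n t (u v : X_space (t 0%N)) (p : word t) : cf_seq t ->
  codes u p -> codes v p ->
  `|(X_val u).1 - (X_val v).1| <= 2^-1 ^+ n.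
Proof.
elim: n t u v p => [|n IH] t u v p ht cu cv; first exact: X_dist.
have [u1 [su cu1]] := codes_uncons cu; have [v1 [sv cv1]] := codes_uncons cv.
have [u2 [su1 cu2]] := codes_uncons cu1; have [v2 [sv1 cv2]] := codes_uncons cv1.
have [/andP[a b] e] := ht 0%N; have [/andP[c d] e'] := ht 1%N.
rewrite (step_dist a su sv) (step_dist c su1 sv1) mulrA exprS.
apply: ler_pM => //; first by rewrite mulr_ge0 // ltW.
  have : 1 * t 0%N <= (cf (t 0%N))%:R * t 0%N.
    by rewrite ler_pM2r // ler1n; exact: cf_gt0.
  have : t 1%N * t 0%N <= 1 * t 0%N by rewrite ler_pM2r // ltW.
  by lra.
exact: IH (cf_seq_shift (cf_seq_shift ht)) cu2 cv2.
Qed.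

Lemma codes_eq1 t (u v : X_space (t 0%N)) (p : word t) : cf_seq t ->
  codes u p -> codes v p -> (X_val u).1 = (X_val v).1.
Proof.
move=> ht cu cv; apply/eqP; rewrite -subr_eq0 -normr_eq0 eq_le normr_ge0 andbT.
rewrite leNgt; apply/negP => d0; set d := `|_| in d0.
(* With n > 1/d, the bounds n <= 2^n and d <= 2^-n are incompatible. *)
have [n nd] : exists n : nat, d^-1 < n%:R.
  exists (Num.truncn d^-1).+1; exact: truncnS_gt.
have := codes_dist n ht cu cv; rewrite -/d exprVn => dn.
have n2 : n%:R <= 2 ^+ n :> R by rewrite -natrX ler_nat ltnW // ltn_expl.
have : d <= d^-1^-1 by rewrite invrK.
move: dn; rewrite -[d]invrK lef_pV2 ?posrE ?invr_gt0 ?exprn_gt0 //; lra.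
Qed.

(** Orders the integers by absolute value, with a negative m after |m|: passing from m < 0 to the
    coefficient |m| has to count as a decrease. *)
Definition weight (m : int) : int := if (m < 0)%R then 1 - 2 * m else 2 * m.

Lemma weight_ge0 m : 0 <= weight m.
Proof. by rewrite /weight; case: ifP; lia. Qed.

Lemma weight_pos m k : 1 <= m -> - m < k < 1 -> weight k < weight m.
Proof. by rewrite /weight; case: ifP; case: ifP; lia. Qed.

Lemma weight_pos_sub m k : 1 <= m -> - m < k < 1 -> k != 1 - m ->
  weight (1 - k) < weight m.
Proof. by rewrite /weight; case: ifP; case: ifP; lia. Qed.

Lemma weight_neg m k : m <= - 1 -> 0 < k < 1 - m -> weight k < weight m.
Proof. by rewrite /weight; case: ifP; case: ifP; lia. Qed.

Lemma weight_neg_sub m k : m <= - 1 -> 0 < k < 1 - m ->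
  weight (1 - k) < weight m.
Proof. by rewrite /weight; case: ifP; case: ifP; lia. Qed.

Lemma int_sign (m : int) : m = 0 \/ 1 <= m \/ m <= -1.
Proof. by lia. Qed.

Lemma int_not_between01 (k : int) : ~~ (0 < k < 1).
Proof. by lia. Qed.

(* A doubled point x = m theta + k is moved by the rescaled induced map to a
   doubled point whose coefficient of theta has smaller weight, until the two
   copies of it are separated by an end of a floor. *)
Lemma codes_separate N t (u v : X_space (t 0%N)) (p : word t) (m k : int) :
  cf_seq t -> codes u p -> codes v p -> (X_val u).1 = m%:~R * t 0%N + k%:~R ->
  (X_val u).2 != (X_val v).2 -> (weight m < N%:Z)%R -> False.
Proof.
elim: N t u v p m k => [|N IH] t u v p m k ht cu cv eu suv wm.
  by move: wm; rewrite ltNge weight_ge0.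
have uv := codes_eq1 ht cu cv.
have [u1 [su cu1]] := codes_uncons cu; have [v1 [sv cv1]] := codes_uncons cv.
have uv1 := codes_eq1 (cf_seq_shift ht) cu1 cv1.
have [/andP[a b] e] := ht 0%N; have [/andP[c d] e'] := ht 1%N.
have [/andP[x0 x1] ul ur _] := X_valP u; have [_ vl vr _] := X_valP v.
have ou : orbit0 (t 0%N) (X_val u).1 by exists m, k.
have {}x0 : 0 < (X_val u).1.
  rewrite lt_neqAle x0 andbT; apply/eqP => /esym u0.
  by move: suv; rewrite ul // vl // -uv.
have {}x1 : (X_val u).1 < 1.
  rewrite lt_neqAle x1 andbT; apply/eqP => u0.
  by move: suv; rewrite ur // vr // -uv.
have [_ _ _ eu1 eu2] := su; have [_ _ _ _ ev2] := sv.
have suv1 : (X_val u1).2 != (X_val v1).2.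
  move: suv; rewrite eu2 // ev2 -?uv //; case: odd; case: (X_val u1).2;
  by case: (X_val v1).2.
have unscale (y m' k' : R) : y * t 0%N = m' * t 0%N + k' ->
    y = m' + k' * ((cf (t 0%N))%:R + t 1%N).
  move=> /(congr1 (fun z => z * ((cf (t 0%N))%:R + t 1%N))).
  rewrite mulrDl -!mulrA [t 0%N * _]mulrC e !mulr1; exact.
(* Rescaling makes k the new coefficient when the rank is even, and 1 - k when it is odd, where 1 -
   x replaces x. *)
have next (m' : int) (n : int) : (weight m' < weight m)%R ->
    (X_val u1).1 = m'%:~R * t 1%N + n%:~R -> False.
  move=> wm' eu1'; apply: (IH _ u1 v1 _ m' n (cf_seq_shift ht) cu1 cv1 eu1' suv1).
  by move: wm; rewrite -addn1 PoszD ltzD1; exact: lt_le_trans.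
set j := (rank (p 0%N))./2 in eu1.
have [m0|[m0|m0]] := int_sign m.
- have /negP[] := int_not_between01 k.
  by rewrite m0 mul0r add0r in eu; rewrite -!(ltr_int R) -eu x0 x1.
- have mR : 1 <= m%:~R :> R by rewrite -(ler_int R) in m0.
  have mt : m%:~R * t 0%N < m%:~R by rewrite gtr_pMr //; lra.
  have mt0 : 0 < m%:~R * t 0%N by rewrite mulr_gt0 //; lra.
  have mk : - m < k < 1.
    by rewrite -!(ltr_int R) intrN; apply/andP; split; lra.
  case odr : (odd (rank (p 0%N))) eu1 => eu1; last first.
    apply: (next k (m + k * (cf (t 0%N))%:Z - j%:Z)).
      exact: weight_pos.
    have := unscale (j%:R + (X_val u1).1) m%:~R k%:~R.
    rewrite -eu1 eu => /(_ erefl); rewrite intrB intrD intrM -!pmulrn; lra.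
  (* The only case in which the weight does not drop. Then x = 1 - m (1 - theta) <= theta, while an
     odd rank puts both copies in [theta, 1]; so x = theta and both flags are [true]. *)
  have [km|km] := eqVneq k (1 - m).
    have := codes_base ht cu; have := codes_base ht cv.
    have -> : rank (p 0%N) != 0%N by case: (rank _) odr.
    rewrite /in_base /between -uv eu km intrB => -[[A|[A s1]] _] [[B|[B s2]] _].
    + by rewrite /= in A; move: A; nra.
    + by move: A B => /=; lra.
    + by move: A B => /=; lra.
    + by rewrite s1 s2 eqxx in suv.
  apply: (next (1 - k) (- m + (1 - k) * (cf (t 0%N))%:Z - j%:Z)).
    exact: weight_pos_sub.
  have := unscale (j%:R + (X_val u1).1) (- m%:~R) (1 - k%:~R).
  have -> : (j%:R + (X_val u1).1) * t 0%N = - m%:~R * t 0%N + (1 - k%:~R).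
    by rewrite eu in eu1; lra.
  by move=> /(_ erefl); rewrite !(intrB, intrD, intrM, intrN) -!pmulrn; lra.
- have mR : m%:~R <= -1 :> R by rewrite -(ler_int R) intrN in m0.
  have mt : m%:~R < m%:~R * t 0%N by nra.
  have mt0 : m%:~R * t 0%N < 0 by nra.
  have mk : 0 < k < 1 - m.
    by rewrite -!(ltr_int R) intrB; apply/andP; split; lra.
  case: (odd (rank (p 0%N))) eu1 => eu1; last first.
    apply: (next k (m + k * (cf (t 0%N))%:Z - j%:Z)).
      exact: weight_neg.
    have := unscale (j%:R + (X_val u1).1) m%:~R k%:~R.
    rewrite -eu1 eu => /(_ erefl); rewrite intrB intrD intrM -!pmulrn; lra.
  apply: (next (1 - k) (- m + (1 - k) * (cf (t 0%N))%:Z - j%:Z)).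
    exact: weight_neg_sub.
  have := unscale (j%:R + (X_val u1).1) (- m%:~R) (1 - k%:~R).
  have -> : (j%:R + (X_val u1).1) * t 0%N = - m%:~R * t 0%N + (1 - k%:~R).
    by rewrite eu in eu1; lra.
  by move=> /(_ erefl); rewrite !(intrB, intrD, intrM, intrN) -!pmulrn; lra.
Qed.

Lemma codes_inj t (u v : X_space (t 0%N)) (p : word t) : cf_seq t ->
  codes u p -> codes v p -> u = v.
Proof.
move=> ht cu cv.
apply: (@X_eq_mod _ _ _ _ 0); first by rewrite addr0 (codes_eq1 ht cu cv).
move=> [m [k e]]; apply/eqP/negPn/negP => suv.
apply: (codes_separate (N := `|weight m|.+1) ht cu cv e suv).
by rewrite -addn1 PoszD gez0_abs ?weight_ge0 // ltrDl.
Qed.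

End CodesInjective.

(** * Cylinders are intervals, and every path is a code *)

Section Cylinders.
Variable R : realType.
Implicit Types t : nat -> R.

(** The condition on the base has content only for n = 0: it keeps the cylinder in the base where
    the first edge of p starts, so that the induction can begin with that base. *)
Definition cylinder t (p : word t) n (u : X_space (t 0%N)) :=
  exists q, [/\ codes u q, in_base (t 0%N) (rank (p 0%N) != 0)%N (X_val u)
    & forall k, (k < n)%N -> q k = p k].

(** By induction: the cylinder of the tail lies in the base of the tower of [p 0], and [place]
    carries it onto the cylinder of p. *)
Lemma cylinder_between n t (p : word t) : cf_seq t -> admissible p ->
  exists l r, [/\ orbit0 (t 0%N) l /\ orbit0 (t 0%N) r,
    lo (t 0%N) (rank (p 0%N) != 0)%N <= l, l < r,
    r <= hi (t 0%N) (rank (p 0%N) != 0)%N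
    & forall u, cylinder p n u <-> between l r (X_val u)].
Proof.
elim: n t p => [|n IH] t p ht ap.
  exists (lo (t 0%N) (rank (p 0%N) != 0)%N), (hi (t 0%N) (rank (p 0%N) != 0)%N).
  split=> //; first by split; [exact: orbit0_lo | exact: orbit0_hi].
    by apply: lo_lt_hi; case: (ht 0%N).
  move=> u; split=> [[q []]//|b].
  by have [q cq] := codes_exists ht u; exists q; split.
have hs := cf_seq_shift ht.
have [l [r [[ol or] ll lr rr H]]] := IH _ (wtail p) hs (fun m => ap m.+1).
have [h0 hE] := ht 0%N; have [h1 _] := ht 1%N.
have k1 := tower_le1 (p 0%N); have rk := rank_tower (p 0%N).
have ek : tower (p 0%N) = (rank (wtail p 0%N) != 0)%N :> nat.
  have [h2 hE'] := ht 1%N; have [h3 _] := ht 2%N.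
  by rewrite ap (floor_sourceE h1 h3 hE').
rewrite -ek in ll rr.
have /andP[l1 l2] := place_base h0 h1 hE k1 rk (x := l)
  (introT andP (conj ll (le_trans (ltW lr) rr))).
have /andP[r1 r2] := place_base h0 h1 hE k1 rk (x := r)
  (introT andP (conj (le_trans ll (ltW lr)) rr)).
have S u (w : X_space (t 1%N)) : step u (tower (p 0%N)) (rank (p 0%N)) w ->
    cylinder p n.+1 u <-> between l r (X_val w).
  move=> st; split=> [[q [cq bu qp]]|/((H w).2) [q [cq bw qp]]].
    apply: (H w).1; have [w' [st' cw]] := codes_uncons cq.
    move: st'; rewrite qp // => st'.
    have [_ _ ww] := step_uniq h0 h1 hE st st'.
    exists (wtail q); split; first by rewrite ww.
      by rewrite -ek; case: st.
    by move=> k kn; rewrite /wtail qp.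
  pose q' : word t := fun m => if m is m'.+1 then q m' else p 0%N.
  exists q'; split; first exact: (codes_cons (p := q') st).
    exact: step_base st.
  by case=> // k kn; exact: qp.
pose a := place (t 0%N) (rank (p 0%N)) l.
pose b := place (t 0%N) (rank (p 0%N)) r.
have lt := place_lt h0 (rank (p 0%N)) lr.
have G u : cylinder p n.+1 u <-> if odd (rank (p 0%N)) then between b a (X_val u)
    else between a b (X_val u).
  split=> [cu|bu].
    have [q [cq _ qp]] := cu.
    have [w [+ _]] := codes_uncons cq; rewrite qp // => st.
    exact: (step_between h0 hE st ol or).1 ((S _ _ st).1 cu).
  (* The ends lie in the floor [p 0], so a point between them makes its first step there. *)
  have fu : in_floor (t 1%N) (tower (p 0%N)) (rank (p 0%N)) u.
    have pl x y : x <= y -> if odd (rank (p 0%N))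
        then place (t 0%N) (rank (p 0%N)) y <= place (t 0%N) (rank (p 0%N)) x
        else place (t 0%N) (rank (p 0%N)) x <= place (t 0%N) (rank (p 0%N)) y.
      rewrite le_eqVlt => /orP[/eqP->|xy]; first by case: ifP.
      by have := place_lt h0 (rank (p 0%N)) xy; case: ifP => _ /ltW.
    move: bu (pl _ _ ll) (pl _ _ rr); rewrite /in_floor.
    by case: odd => bu *; apply: between_sub bu.
  have [w st] := in_floor_step h0 h1 hE k1 rk fu.
  exact: (S _ _ st).2 ((step_between h0 hE st ol or).2 bu).
have oa := orbit0_place hE (rank (p 0%N)) ol.
have ob := orbit0_place hE (rank (p 0%N)) or.
case: (odd _) lt G => lt G; [exists b, a | exists a, b]; split=> //.
Qed.

(** The cylinders are nested intervals, and the supremum L of their left ends carries a common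
    point; it remains to choose the right copy of L. *)
Lemma codes_surj t (p : word t) : cf_seq t -> admissible p ->
  exists u : X_space (t 0%N), codes u p.
Proof.
move=> ht ap; have [h0 hE] := ht 0%N; have [h1 _] := ht 1%N.
have /choice[lr H] : forall n, exists lr : R * R,
  [/\ orbit0 (t 0%N) lr.1, orbit0 (t 0%N) lr.2,
    [/\ 0 <= lr.1, lr.1 < lr.2 & lr.2 <= 1]
    & forall u, cylinder p n u <-> between lr.1 lr.2 (X_val u)].
  move=> n; have [l [r [[ol or] ll lr rr H]]] := cylinder_between n ht ap.
  exists (l, r); split=> //; split=> //.
    by apply: le_trans ll; exact: lo_ge0.
  by apply: (le_trans rr); exact: hi_le1.
pose l n := (lr n).1; pose r n := (lr n).2.
rewrite -/(l _) -/(r _) in H.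
have nest m n u : (m <= n)%N -> cylinder p n u -> cylinder p m u.
  move=> mn [q [cq bu qp]]; exists q; split=> // k km.
  by apply: qp; exact: leq_trans mn.
(* Monotonicity of the ends is read off by testing the inclusion of cylinders on the points l n + 0
   and r n - 0. *)
have lm m n : (m <= n)%N -> l m <= l n /\ r n <= r m.
  move=> mn; have [oln orn [l0 lrn rn1] Hn] := H n; have [_ _ _ Hm] := H m.
  have [u [eu su]] : exists u : X_space (t 0%N), (X_val u).1 = l n /\
      (orbit0 (t 0%N) (l n) -> (X_val u).2 = true).
    by apply: X_exists => //; [apply/andP; split; lra | lra].
  have [v [ev sv]] : exists u : X_space (t 0%N), (X_val u).1 = r n /\
      (orbit0 (t 0%N) (r n) -> (X_val u).2 = false).
    by apply: X_exists => //; [apply/andP; split; lra | lra].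
  have /(nest _ _ _ mn)/Hm[A _] : cylinder p n u.
    by apply/Hn; split; rewrite eu; [right; rewrite su|left].
  have /(nest _ _ _ mn)/Hm[_ B] : cylinder p n v.
    by apply/Hn; split; rewrite ev; [left|right; rewrite sv].
  by split; [case: A => [|[]]; rewrite eu; lra | case: B => [|[]]; rewrite ev; lra].
have llr m n : l m < r n.
  have [_ _ [_ ? _] _] := H (maxn m n).
  have [? _] := lm _ _ (leq_maxl m n); have [_ ?] := lm _ _ (leq_maxr m n).
  by lra.
pose L := sup (range l).
have Ll n : l n <= L.
  apply: ub_le_sup; last by exists n.
  by exists (r 0%N) => _ [m _ <-]; exact: ltW.
have Lr n : L <= r n.
  apply: ge_sup; first by exists (l 0%N), 0%N.
  by move=> _ [m _ <-]; exact: ltW.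
have [u Hu] : exists u : X_space (t 0%N), forall n,
    between (l n) (r n) (X_val u).
  have [_ _ [l00 _ r01] _] := H 0%N; have Ll0 := Ll 0%N; have Lr0 := Lr 0%N.
  (* If L is one of the right ends, then L - 0 is common to all intervals, as every l m is below L.
     Otherwise L + 0 is, even if L is one of the left ends. *)
  have [[n Ln]|Ln] := pselect (exists n, L = r n).
    have lL m : l m < L by rewrite Ln.
    have [u [eu su]] : exists u : X_space (t 0%N), (X_val u).1 = L /\
        (orbit0 (t 0%N) L -> (X_val u).2 = false).
      apply: X_exists => //; first by apply/andP; split; lra.
      by have := lL 0%N; lra.
    exists u => m; split; rewrite eu; first by left.
    have [_ orn _ _] := H n.
    have := Lr m; rewrite le_eqVlt => /orP[/eqP|]; last by left.
    by right; rewrite su // Ln.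
  have Lr' m : L < r m.
    by rewrite lt_neqAle Lr andbT; apply/eqP => e; apply: Ln; exists m.
  have [u [eu su]] : exists u : X_space (t 0%N), (X_val u).1 = L /\
      (orbit0 (t 0%N) L -> (X_val u).2 = true).
    apply: X_exists => //; first by apply/andP; split; lra.
    by have := Lr' 0%N; lra.
  exists u => m; split; rewrite eu; last by left.
  have [olm _ _ _] := H m.
  have := Ll m; rewrite le_eqVlt => /orP[/eqP e|]; last by left.
  by right; rewrite su // -e.
have [q cq] := codes_exists ht u; exists u.
rewrite (_ : p = q) //; apply: functional_extensionality_dep => n.
have [_ _ _ Hn] := H n.+1; have [q' [cq' _ <-]] := (Hn u).2 (Hu n.+1) => //.
by rewrite (codes_uniq ht cq cq').
Qed.

End Cylinders.

(** * The path space and the natural action *)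

Section PathSpace.
Variable B : bratteli.
Implicit Types p q : Omega B.

Lemma Omega_eq p q : (forall n, edge_at p n = edge_at q n) -> p = q.
Proof.
by move=> pq; apply: val_inj; apply: functional_extensionality_dep.
Qed.

Lemma edge_at_continuous n :
  continuous (fun p : Omega B => edge_at p n : discrete_topology (bE B n)).
Proof.
pose K k : topologicalType := discrete_topology (bE B k).
have c1 : continuous (set_val : Omega B -> prod_topology K).
  exact: initial_continuous.
move=> p; exact: continuous_comp (c1 p) (@proj_continuous nat K n (set_val p)).
Qed.

Lemma near_edge_at p n : \forall q \near p, edge_at q n = edge_at p n.
Proof.
have : nbhs (edge_at p n : discrete_topology (bE B n))
    [set e | e = edge_at p n] by rewrite nbhs_principalE.
exact: edge_at_continuous.
Qed.

Lemma near_prefix p n :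
  \forall q \near p, forall k, (k < n)%N -> edge_at q k = edge_at p k.
Proof.
elim: n => [|n IH]; first by apply: (@filterE _ (nbhs p)) => q k; rewrite ltn0.
apply: (@filterS2 _ (nbhs p) _ _ _ _ _ IH (near_edge_at p n)) => q pq pqn k.
by rewrite ltnS leq_eqVlt => /orP[/eqP->//|]; exact: pq.
Qed.

(** The topology is induced from a product of discrete spaces, so it is enough that each edge of the
    image is locally constant. *)
Lemma continuous_Omega (T : topologicalType) (f : T -> Omega B) :
  (forall x n, \forall y \near x, edge_at (f y) n = edge_at (f x) n) ->
  continuous f.
Proof.
move=> hf; apply: continuous_comp_initial => x; apply/cvg_sup => n.
apply: (@continuous_comp_initial _ _ _ (@proj nat _ n)) => {}x.
move=> A; rewrite nbhs_principalE => /= Ax.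
apply: (@filterS _ (nbhs x) _ _ _ _ (hf x n)) => y /= e.
exact: Ax.
Qed.

End PathSpace.

(** * Uniqueness and continuity of the natural action *)

Section NaturalAction.
Variables (R : realType) (theta : R).
Local Notation D i := (tail_diagram theta i).
Implicit Types act : forall i, Omega (D i) -> gen -> Omega (D i).

(** Rules (i)-(iii) leave no case open: [step_gen (rank e)] leads to the next floor, or is outer on
    the last one; the other generator leads back, or is b at rank 0. *)
Lemma floor_cases c (e : floors c) (x : gen) :
  [\/ exists e', neighbors x e e', rank e = 0%N /\ x = Gb | outer x e].
Proof.
have re : (rank e < c.+1 - tower e)%N by exact: ltn_ord.
have [xs|xs] := pselect (x = step_gen (rank e)).
  have [re'|re'] := ltnP (rank e).+1 (c.+1 - tower e).
    apply: Or31; exists (existT _ (tower e) (Ordinal re')); split=> //.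
    by left.
  by apply: Or33; split=> //; apply/eqP; rewrite eqn_leq re re'.
case r0 : (rank e) => [|r].
  by apply: Or32; split=> //; move: xs; rewrite r0; case: x.
apply: Or31; have re' : (r < c.+1 - tower e)%N by rewrite -r0 ltnW.
exists (existT _ (tower e) (Ordinal re')); split=> //; right; split=> //=.
by move: xs; rewrite r0 /step_gen /=; case: odd; case: x.
Qed.

(** Rule (ii) concerns b only, so under a the first edge of the image depends on the first edge
    alone. *)
Lemma natural_first act act' i p q :
  natural_action act -> natural_action act' -> edge_at p 0 = edge_at q 0 ->
  edge_at (act i p Ga) 0 = edge_at (act' i q Ga) 0.
Proof.
move=> na na' pq; have [n1 _ n3] := na i p; have [n1' _ n3'] := na' i q.
have [[e' ne]|[_ //]|oe] := floor_cases (edge_at p 0) Ga.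
  have [-> _] := n1 _ _ ne; rewrite pq in ne.
  by have [-> _] := n1' _ _ ne.
have [-> _] := n3 _ oe; rewrite pq in oe.
by have [-> _] := n3' _ oe.
Qed.

(** Comparing two actions on two paths yields uniqueness (p = q) and continuity (one action) at
    once. The extra edge is needed for rule (ii), where the first edge of the image depends on that
    of the tail moved by a. *)
Lemma natural_local act act' : natural_action act -> natural_action act' ->
  forall n i p q x, (forall k, (k <= n.+1)%N -> edge_at p k = edge_at q k) ->
  edge_at (act i p x) n = edge_at (act' i q x) n.
Proof.
move=> na na'; elim=> [|n IH] i p q x pq.
  have [n1 n2 n3] := na i p; have [n1' n2' n3'] := na' i q.
  have pq0 := pq 0%N isT; have [[e' ne]|[re ->]|oe] := floor_cases (edge_at p 0) x.
  - have [-> _] := n1 _ _ ne; rewrite pq0 in ne.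
    by have [-> _] := n1' _ _ ne.
  - have [e [e0 te [-> _]]] := n2 re; rewrite pq0 in re.
    have [e' [e0' te' [-> _]]] := n2' re.
    apply: floors_eq; last by rewrite e0 e0'.
    rewrite te te'; apply: congr1.
    exact: (@natural_first act act' i.+1 (ptail p) (ptail q) na na' (pq 1%N isT)).
  - have [-> _] := n3 _ oe; rewrite pq0 in oe.
    by have [-> _] := n3' _ oe.
have [n1 n2 n3] := na i p; have [n1' n2' n3'] := na' i q.
have pq0 := pq 0%N isT.
have tl (p' : Omega (D i)) : edge_at p' n.+1 = edge_at (ptail p') n by [].
have [[e' ne]|[re ->]|oe] := floor_cases (edge_at p 0) x; rewrite !tl.
- have [_ ->] := n1 _ _ ne; rewrite pq0 in ne.
  have [_ ->] := n1' _ _ ne; exact: pq n.+1 _.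
- have [e [_ _ [_ ->]]] := n2 re; rewrite pq0 in re.
  have [e' [_ _ [_ ->]]] := n2' re.
  exact: (IH i.+1 (ptail p) (ptail q) Ga (fun k kn => pq k.+1 kn)).
- have [_ ->] := n3 _ oe; rewrite pq0 in oe.
  have [_ ->] := n3' _ oe.
  exact: (IH i.+1 (ptail p) (ptail q) Gb (fun k kn => pq k.+1 kn)).
Qed.

Lemma natural_uniq act act' :
  natural_action act -> natural_action act' -> act = act'.
Proof.
move=> na na'; apply: functional_extensionality_dep => i.
apply/funext => p; apply/funext => x; apply: Omega_eq => n.
exact: natural_local.
Qed.

Lemma natural_continuous act i x :
  natural_action act -> continuous (fun p => act i p x).
Proof.
move=> na; apply: continuous_Omega => p n.
apply: (@filterS _ (nbhs p) _ _ _ _ (near_prefix p n.+2)) => q pq.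
by apply: natural_local => // k kn; rewrite pq.
Qed.

End NaturalAction.

(** * The conjugacy *)

Section Coding.
Variable R : realType.
Implicit Types t : nat -> R.

Lemma Omega_admissible t (p : Omega (tower_diagram t)) :
  admissible (edge_at p : word t).
Proof. by move=> n; have /set_mem/(_ n) := valP p. Qed.

Lemma Omega_word t (w : word t) : admissible w ->
  exists p : Omega (tower_diagram t), edge_at p = w.
Proof.
move=> aw; have Aw : w \in path_set (tower_diagram t) by apply/mem_set => n; exact: aw.
by exists (SigSub Aw).
Qed.

Definition point_of t (ht : cf_seq t) (p : Omega (tower_diagram t)) :
  X_space (t 0%N) := sval (cid (codes_surj ht (Omega_admissible p))).

Lemma point_of_codes t (ht : cf_seq t) (p : Omega (tower_diagram t)) :
  codes (point_of ht p) (edge_at p : word t).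
Proof. exact: (svalP (cid (codes_surj ht (Omega_admissible p)))). Qed.

Lemma path_exists t (u : X_space (t 0%N)) : cf_seq t ->
  exists p : Omega (tower_diagram t), codes u (edge_at p : word t).
Proof.
move=> ht; have [w cw] := codes_exists ht u.
by have [p pw] := Omega_word (codes_admissible ht cw); exists p; rewrite pw.
Qed.

Definition path_of t (ht : cf_seq t) (u : X_space (t 0%N)) :
  Omega (tower_diagram t) := sval (cid (path_exists u ht)).

Lemma path_of_codes t (ht : cf_seq t) (u : X_space (t 0%N)) :
  codes u (edge_at (path_of ht u) : word t).
Proof. exact: (svalP (cid (path_exists u ht))). Qed.

Lemma point_ofE t (ht : cf_seq t) (p : Omega (tower_diagram t))
  (u : X_space (t 0%N)) : codes u (edge_at p : word t) -> point_of ht p = u.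
Proof. by move=> cu; exact: codes_inj ht (point_of_codes ht p) cu. Qed.

Lemma path_ofE t (ht : cf_seq t) (p : Omega (tower_diagram t))
  (u : X_space (t 0%N)) : codes u (edge_at p : word t) -> path_of ht u = p.
Proof.
move=> cu; apply: Omega_eq => n; have := codes_uniq ht (path_of_codes ht u) cu.
by move=> /(congr1 (fun f : word t => f n)).
Qed.

Lemma path_ofK t (ht : cf_seq t) : cancel (path_of ht) (point_of ht).
Proof. by move=> u; apply: point_ofE; exact: path_of_codes. Qed.

Lemma point_ofK t (ht : cf_seq t) : cancel (point_of ht) (path_of ht).
Proof. by move=> p; apply: path_ofE; exact: point_of_codes. Qed.

Section OneStep.
Variables (t : nat -> R) (ht : cf_seq t) (hs : cf_seq (seq_shift t)).
Implicit Types (p : Omega (tower_diagram t)).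

(** The action on points carried over to paths by the coding. *)
Definition transport t (ht : cf_seq t) (p : Omega (tower_diagram t)) (x : gen) :=
  path_of ht (X_act (point_of ht p) x).

Lemma path_of_cons (u : X_space (t 0%N)) (e : floors (cf (t 0%N)))
    (w : X_space (t 1%N)) (q : Omega (tower_diagram (seq_shift t))) :
  step u (tower e) (rank e) w -> @codes _ (seq_shift t) w (edge_at q) ->
  @is_cons (tower_diagram t) (path_of ht u) e q.
Proof.
move=> st cw.
pose v : word t := fun n => if n is m.+1 then edge_at q m else e.
have cu : codes u v by exact: (codes_cons (p := v) st).
have [p pv] := Omega_word (codes_admissible ht cu).
rewrite (path_ofE ht (p := p)) ?pv //; split; first by rewrite pv.
apply: Omega_eq => n; have <- : v n.+1 = edge_at q n by [].
by rewrite -pv.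
Qed.

Lemma point_of_step p : step (point_of ht p) (tower (edge_at p 0%N))
  (rank (edge_at p 0%N)) (point_of hs (ptail p)).
Proof.
have [w [st cw]] := codes_uncons (point_of_codes ht p).
by rewrite (point_ofE hs (p := ptail p) (u := w) cw).
Qed.

Let h0 n : 0 < t n < 1. Proof. by case: (ht n). Qed.
Let hE n : ((cf (t n))%:R + t n.+1) * t n = 1. Proof. by case: (ht n). Qed.

(** For each rule, [step_point] builds a point with the predicted code, and one of [step_neighbors],
    [step_first] and [step_last] recognises it as the image, a mirror image being unique. *)
Lemma transport_natural p :
  let e := edge_at p 0 in
  let p' : Omega (tower_diagram (seq_shift t)) := ptail p in
  [/\ forall x e', neighbors x e e' -> is_cons (transport ht p x) e' p',
      rank e = 0%N ->
        let q := transport hs p' Ga in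
        exists e', [/\ rank e' = 0%N, tower e' = bs (edge_at q 0)
                     & is_cons (transport ht p Gb) e' q]
    & forall x, outer x e ->
        is_cons (transport ht p x) e (transport hs p' Gb)].
Proof.
move=> e p'; have st := point_of_step p; rewrite -/e -/p' in st.
have cp' : @codes _ (seq_shift t) _ (edge_at p') := point_of_codes hs p'.
have [k1 rk b _ _] := st.
split.
- move=> x e' [te re]; have rk' := rank_tower e'; rewrite -te in rk'.
  have [v sv] := step_point (h0 0%N) (h0 1%N) (hE 0%N) k1 rk' b.
  have m : mirror x (point_of ht p) v.
    case: re => -[r' ->].
      by rewrite r' in sv; exact: step_neighbors (hE 0%N) _ _ _ _ _ st sv.
    apply: mirror_sym; rewrite r' in st.
    exact: step_neighbors (hE 0%N) _ _ _ _ _ sv st.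
  rewrite /transport (mirrorE m); apply: path_of_cons cp'.
  by rewrite -te.
- move=> r0 q; pose w := X_act (point_of hs p') Ga.
  have cq : @codes _ (seq_shift t) w (edge_at q) by exact: path_of_codes.
  have bw := codes_base hs cq.
  have eq0 : bs (edge_at q 0) = (rank (edge_at q 0) != 0)%N :> nat.
    exact: floor_sourceE (h0 1%N) (h0 2%N) (hE 1%N) _.
  have c1 := cf_gt0 ht.
  have k'1 : (bs (edge_at q 0) <= 1)%N by rewrite eq0; case: eqP.
  (* Tower 1 has a floor of rank 0 because c is positive. *)
  have [e' [te' re']] := @floors_exists (cf (t 0%N)) (bs (edge_at q 0)) 0
    (leq_trans k'1 c1).
  rewrite -eq0 in bw.
  have [v sv] := step_point (h0 0%N) (h0 1%N) (hE 0%N) k'1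
    (leq_trans k'1 c1 : (0 + _ <= _)%N) bw.
  rewrite r0 in st.
  have m := step_first (hE 0%N) st (mirror_act Ga _) sv.
  exists e'; split=> //; rewrite /transport (mirrorE m).
  by apply: path_of_cons cq; rewrite te' re'.
- move=> x [er ->]; have rkc : (rank e + tower e = cf (t 0%N))%N.
    by move: er (ltn_ord (tower e)) rk; move: (rank e) (tower e) => r k; lia.
  have m := mirror_act Gb (point_of hs p').
  have [_ bw] := mirror_base (h0 1%N) k1 b m.
  have [v sv] := step_point (h0 0%N) (h0 1%N) (hE 0%N) k1 rk bw.
  have m' := step_last (h0 1%N) (hE 0%N) st rkc m sv.
  rewrite /transport (mirrorE m'); apply: path_of_cons sv _.
  exact: path_of_codes.
Qed.

End OneStep.

End Coding.

(** * Intervals in the order topology *)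

Section XTopology.
Variables (R : realType) (theta : R).
Implicit Types (u v a : X_space theta) (l r : R).

Lemma near_gt a u : (a < u)%O -> nbhs u [set v | (a < v)%O].
Proof.
move=> au; have := @rray_open _ (X_space theta) a.
rewrite openE => /(_ u) /=; rewrite in_itv /= andbT => /(_ au).
by apply: filterS => v /=; rewrite in_itv /= andbT.
Qed.

Lemma near_lt a u : (u < a)%O -> nbhs u [set v | (v < a)%O].
Proof.
move=> au; have := @lray_open _ (X_space theta) a.
rewrite openE => /(_ u) /=; rewrite in_itv /= => /(_ au).
by apply: filterS => v /=; rewrite in_itv /=.
Qed.

(** No point lies between l - 0 and l + 0, so the condition at l is the open ray above l - 0; for l
    = 0 it always holds. The right end is symmetric. *)
Lemma near_between l r u : orbit0 theta l -> orbit0 theta r ->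
  0 <= l -> l < r -> r <= 1 -> between l r (X_val u) ->
  nbhs u [set v | between l r (X_val v)].
Proof.
move=> ol or l0 lr r1 [A B]; apply: filterI.
  have [le0|lN0] := eqVneq l 0.
    apply: (@filterE _ (nbhs u)) => v; have [/andP[v0 _] vl _ _] := X_valP v.
    move: v0; rewrite le_eqVlt le0 => /orP[/eqP e|]; last by left.
    by right; rewrite vl.
  have [a [ea sa]] : exists a, (X_val a).1 = l /\
      (orbit0 theta l -> (X_val a).2 = false).
    apply: X_exists => //; first by apply/andP; split; lra.
    by move=> e; rewrite e eqxx in lN0.
  have au : (a < u)%O.
    apply/X_ltP; rewrite ea sa //; case: A => [|[]]; by [left|right].
  apply: (@filterS _ (nbhs u) _ _ _ _ (near_gt au)) => v /X_ltP.
  by rewrite ea => -[|[]]; [left|right].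
have [re1|rN1] := eqVneq r 1.
  apply: (@filterE _ (nbhs u)) => v; have [/andP[_ v1] _ vr _] := X_valP v.
  move: v1; rewrite le_eqVlt re1 => /orP[/eqP e|]; last by left.
  by right; rewrite vr.
have [a [ea sa]] : exists a, (X_val a).1 = r /\
    (orbit0 theta r -> (X_val a).2 = true).
  apply: X_exists => //; first by apply/andP; split; lra.
  by move=> e; rewrite e eqxx in rN1.
have ua : (u < a)%O.
  apply/X_ltP; rewrite ea sa //; case: B => [|[]]; by [left|right].
apply: (@filterS _ (nbhs u) _ _ _ _ (near_lt ua)) => v /X_ltP.
by rewrite ea => -[|[]]; [left|right].
Qed.

Lemma between_convex l r u v a : (u < a)%O -> (a < v)%O ->
  between l r (X_val u) -> between l r (X_val v) -> between l r (X_val a).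
Proof.
move=> /X_ltP ua /X_ltP av [lu _] [_ vr]; split.
  case: ua lu => [ua|[ua su sa]] [lu|[lu su']]; try by left; lra.
  by right; rewrite lu ua.
case: av vr => [av|[av sa sv]] [vr|[vr sv']]; try by left; lra.
by right; rewrite av vr.
Qed.

End XTopology.

(** * The coding is a homeomorphism *)

Section Homeomorphism.
Variables (R : realType) (t : nat -> R).
Hypothesis ht : cf_seq t.
Implicit Types (p q : Omega (tower_diagram t)) (u v a : X_space (t 0%N)).

Lemma cylinder_prefix p n u q : codes u (edge_at q : word t) ->
  (forall k, (k < n.+1)%N -> edge_at q k = edge_at p k) ->
  cylinder (edge_at p : word t) n.+1 u.
Proof.
move=> cu qp; exists (edge_at q); split => //.
by have := codes_base ht cu; rewrite qp.
Qed.

Lemma path_of_continuous : continuous (path_of ht).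
Proof.
apply: continuous_Omega => u n; pose p := path_of ht u.
have [l [r [[ol or] ll lr rr H]]] :=
  cylinder_between n.+1 ht (Omega_admissible p).
have l0 : 0 <= l by apply: le_trans ll; apply: lo_ge0; case: (ht 0%N).
have r1 : r <= 1 by apply: (le_trans rr); apply: hi_le1; case: (ht 0%N).
have /(H u)/(near_between ol or l0 lr r1) Hu : cylinder (edge_at p : word t) n.+1 u.
  by apply: cylinder_prefix (path_of_codes ht u) _.
apply: (@filterS _ (nbhs u) _ _ _ _ Hu) => v /(H v) [q [cv _ qp]].
have -> : edge_at (path_of ht v) n = q n.
  by rewrite (codes_uniq ht cv (path_of_codes ht v)).
exact: qp.
Qed.

(** The codes of a and of the point of p differ at some edge, so a cylinder around p misses a; being
    convex, it lies on one side of a. *)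
Lemma separating_prefix p a : a <> point_of ht p -> exists n, forall q,
  (forall k, (k < n)%N -> edge_at q k = edge_at p k) ->
  ((a < point_of ht p)%O -> (a < point_of ht q)%O) /\
  ((point_of ht p < a)%O -> (point_of ht q < a)%O).
Proof.
move=> ap; pose pa := path_of ht a; have ca := path_of_codes ht a.
have [n pn] : exists n, edge_at pa n <> edge_at p n.
  apply: contrapT => /forallNP pap; apply: ap.
  rewrite -(path_ofK ht a) -/pa; congr point_of; apply: Omega_eq => n.
  exact: contrapT (pap n).
have [l [r [_ _ _ _ H]]] := cylinder_between n.+1 ht (Omega_admissible p).
have na : ~ between l r (X_val a).
  move=> /(H a)[w [cw _ wp]]; apply: pn; rewrite -wp //.
  by rewrite (codes_uniq ht cw ca).
have bp : between l r (X_val (point_of ht p)).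
  by apply/H; apply: cylinder_prefix (point_of_codes ht p) _.
exists n.+1 => q qp; have bq : between l r (X_val (point_of ht q)).
  by apply/H; apply: cylinder_prefix (point_of_codes ht q) _.
split=> ab; rewrite ltNge le_eqVlt; apply/negP => /orP[/eqP e|qa].
- by apply: na; rewrite -e.
- exact: na (between_convex qa ab bq bp).
- by apply: na; rewrite e.
- exact: na (between_convex ab qa bp bq).
Qed.

Lemma point_of_continuous : continuous (point_of ht).
Proof.
move=> p A; rewrite itv_nbhsE => -[i [oi pi] iA].
(* Each end of the open interval i, if there is one, is handled separately. *)
suff : nbhs p [set q | point_of ht q \in i].
  by apply: filterS => q qi; exact: iA.
have sep a : (a < point_of ht p)%O || (point_of ht p < a)%O ->
    nbhs p [set q | ((a < point_of ht p)%O -> (a < point_of ht q)%O) /\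
                    ((point_of ht p < a)%O -> (point_of ht q < a)%O)].
  move=> ap; have [n Hn] : exists n, forall q,
      (forall k, (k < n)%N -> edge_at q k = edge_at p k) ->
      ((a < point_of ht p)%O -> (a < point_of ht q)%O) /\
      ((point_of ht p < a)%O -> (point_of ht q < a)%O).
    by apply: separating_prefix => e; move: ap; rewrite e ltxx.
  by apply: (@filterS _ (nbhs p) _ _ _ _ (near_prefix p n)) => q /Hn.
have lower a : (a < point_of ht p)%O -> nbhs p [set q | (a < point_of ht q)%O].
  move=> ap; have := sep a (introT orP (or_introl ap)).
  by apply: filterS => q [/(_ ap)].
have upper a : (point_of ht p < a)%O -> nbhs p [set q | (point_of ht q < a)%O].
  move=> ap; have := sep a (introT orP (or_intror ap)).
  by apply: filterS => q [_ /(_ ap)].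
case: i oi pi {iA} => [[[] a|[]] [[] b|[]]] //= _;
  rewrite in_itv /= ?andbT => pab.
- case/andP: pab => /lower pa /upper pb.
  by apply: filterS (filterI pa pb) => q [qa qb] /=; rewrite in_itv /= qa.
- by apply: filterS (lower _ pab) => q /=; rewrite in_itv /= andbT.
- by apply: filterS (upper _ pab) => q /=; rewrite in_itv.
- by apply: (@filterE _ (nbhs p)) => q; rewrite /= in_itv.
Qed.

Lemma point_of_homeomorphism : homeomorphism (point_of ht).
Proof.
split; first exact: point_of_continuous.
exists (path_of ht); split; [exact: path_of_continuous|exact: point_ofK|exact: path_ofK].
Qed.

End Homeomorphism.

(** * Continued fractions and edge counts *)

Section ContinuedFraction.
Variable R : realType.
Implicit Types (theta x : R) (c : nat -> nat).

Lemma rational_nat n : rational (n%:R : R).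
Proof. by exists n%:R; rewrite // ratr_nat. Qed.

Lemma rationalD x y : rational x -> rational y -> rational (x + y).
Proof. by move=> [p _ <-] [q _ <-]; exists (p + q); rewrite // rmorphD. Qed.

Lemma rationalV x : rational x -> rational x^-1.
Proof. by move=> [p _ <-]; exists p^-1; rewrite // fmorphV. Qed.

Lemma gauss_itv theta : 0 < theta < 1 -> irrational theta ->
  [/\ 0 < gauss theta < 1, irrational (gauss theta)
    & ((cf theta)%:R + gauss theta) * theta = 1].
Proof.
move=> /andP[t0 t1] irr.
have e : theta^-1 = (cf theta)%:R + gauss theta by rewrite /gauss addrC subrK.
have irr' : irrational (gauss theta).
  move=> rg; apply: irr; rewrite -[theta]invrK e; apply: rationalV.
  by apply: rationalD => //; exact: rational_nat.
have /andP[f0 f1] : (cf theta)%:R <= theta^-1 < (cf theta).+1%:R.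
  by apply: truncn_itv; rewrite invr_ge0 ltW.
split=> //; last by rewrite -e mulVf // gt_eqF.
rewrite -natr1 in f1; apply/andP; split; last by rewrite /gauss; lra.
rewrite lt_neqAle; apply/andP; split; last by rewrite /gauss; lra.
by apply/eqP => g0; apply: irr'; rewrite -g0; exact: (rational_nat 0).
Qed.

Lemma theta_seq_itv theta : 0 < theta < 1 -> irrational theta ->
  forall n, 0 < theta_seq theta n < 1 /\ irrational (theta_seq theta n).
Proof.
by move=> t01 irr; elim=> [|n [h1 h2]] //; have [? ? _] := gauss_itv h1 h2.
Qed.

Lemma theta_seq_cf_seq theta : 0 < theta < 1 -> irrational theta ->
  cf_seq (theta_seq theta).
Proof.
move=> t01 irr n; have [h1 h2] := theta_seq_itv t01 irr n.
by have [_ _] := gauss_itv h1 h2.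
Qed.

Lemma cfrac_itv c n : (forall n, (0 < c n)%N) -> 0 <= cfrac R c n <= 1.
Proof.
elim: n c => [|n IH] c c0 /=; first by rewrite lexx ler01.
have /andP[y0 y1] := IH (fun i => c i.+1) (fun i => c0 i.+1).
have : 1 <= (c 0%N)%:R :> R by rewrite ler1n.
move=> c1; rewrite invr_ge0 addr_ge0 //= invf_le1; lra.
Qed.

(** Inverting one level, the tails converge to 1/theta - c 0, which lies in [0, 1] as they do.
    Irrationality excludes the value 1, so c 0 is the integer part of 1/theta. *)
Lemma cfrac_cvg theta c : 0 < theta < 1 -> irrational theta ->
  (forall n, (0 < c n)%N) -> cfrac R c n @[n --> \oo] --> theta ->
  cf theta = c 0%N /\ cfrac R (fun i => c i.+1) n @[n --> \oo] --> gauss theta.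
Proof.
move=> /andP[t0 t1] irr c0 cc; pose y n := cfrac R (fun i => c i.+1) n.
have cy : y n @[n --> \oo] --> theta^-1 - (c 0%N)%:R.
  have -> : y = (fun n => (cfrac R c n.+1)^-1 - (c 0%N)%:R).
    by apply/funext => n /=; rewrite invrK addrC addKr.
  apply: cvgB; last exact: cvg_cst.
  by apply: cvgV; [rewrite gt_eqF|rewrite (cvg_shiftS (cfrac R c))].
have y01 n : 0 <= y n <= 1 by exact: cfrac_itv.
have irr' (n : nat) : theta^-1 != n%:R.
  apply/eqP => e; apply: irr; rewrite -[theta]invrK e.
  exact/rationalV/rational_nat.
have lim0 : 0 <= theta^-1 - (c 0%N)%:R.
  rewrite -(cvg_lim _ cy) //; apply: limr_ge; first by apply/cvg_ex; eexists; exact: cy.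
  by apply: nearW => n; case/andP: (y01 n).
have lim1 : theta^-1 - (c 0%N)%:R <= 1.
  rewrite -(cvg_lim _ cy) //; apply: limr_le; first by apply/cvg_ex; eexists; exact: cy.
  by apply: nearW => n; case/andP: (y01 n).
have ec : cf theta = c 0%N.
  apply: truncn_def; apply/andP; split; first by lra.
  by rewrite lt_neqAle irr' /= -natr1; lra.
by split; rewrite // /gauss ec.
Qed.

Lemma cfrac_theta_seq theta c : 0 < theta < 1 -> irrational theta ->
  (forall n, (0 < c n)%N) -> cfrac R c n @[n --> \oo] --> theta ->
  forall n, cf (theta_seq theta n) = c n.
Proof.
move=> + + + + n; elim: n theta c => [|n IH] theta c t01 irr c0 cc.
  by case: (cfrac_cvg t01 irr c0 cc).
have [h1 h2 _] := gauss_itv t01 irr; have [_ cc'] := cfrac_cvg t01 irr c0 cc.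
by have := IH _ _ h1 h2 (fun i => c0 i.+1) cc'; rewrite /theta_seq -iterSr.
Qed.

Lemma cf_ge2 theta : 0 < theta < 1 -> irrational theta ->
  (theta < 1 / 2 <-> (2 <= cf theta)%N) /\ (theta > 1 / 2 <-> cf theta = 1%N).
Proof.
move=> /andP[t0 t1] irr; have i0 : 0 <= theta^-1 by rewrite invr_ge0 ltW.
have t2 : theta != 1 / 2.
  apply/eqP => e; apply: irr; rewrite e div1r.
  exact/rationalV/rational_nat.
have E : (2 <= cf theta)%N = (theta <= 1 / 2).
  rewrite truncn_ge_nat // div1r -[X in X <= _]invrK lef_pV2 //.
  by rewrite posrE invr_gt0.
have C1 : (1 <= cf theta)%N.
  by rewrite truncn_ge_nat // invf_ge1 // ltW.
rewrite E; split; first by rewrite le_eqVlt (negbTE t2).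
rewrite ltNge -E; split=> [|->] //; lia.
Qed.

End ContinuedFraction.

(** * Counting the floors of a tower by rank *)

Section Counting.

Lemma card_tower c (P : pred nat) (k : 'I_2) :
  #|[pred e : floors c | P (rank e) && (tower e == k)]|
  = #|[pred i : 'I_(c.+1 - k) | P i]|.
Proof.
pose f (i : 'I_(c.+1 - k)) : floors c := existT (fun k : 'I_2 => 'I_(c.+1 - k)) k i.
have fI : injective f by move=> i j /(congr1 (@rank c)) /= /val_inj.
rewrite -(fintype.card_image fI); apply: eq_card => e; rewrite inE /=.
apply/andP/fintype.imageP => [[Pe /eqP ek]|[i Pi ->]]; last by split.
by move: @f fI; rewrite -ek; case: e {ek} Pe => k' i Pi f _; exists i.
Qed.

Lemma card_ord_eq0 m : (0 < m)%N -> #|[pred i : 'I_m | i == 0 :> nat]%N| = 1%N.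
Proof.
case: m => // m _; rewrite -(card1 (ord0 : 'I_m.+1)).
by apply: eq_card => i; rewrite !inE.
Qed.

Lemma card_ord_neq0 m : #|[pred i : 'I_m | i != 0 :> nat]%N| = m.-1.
Proof.
case: m => [|m]; first by apply: eq_card0 => -[].
rewrite -[in RHS](card_ord m.+1) -(cardC1 (ord0 : 'I_m.+1)).
by apply: eq_card => i; rewrite !inE.
Qed.

End Counting.

(** * The diagram of theta, its natural action and the conjugacy *)

Theorem theorem5p2 (R : realType) (theta : R) (c : nat -> nat)
    (theta01 : 0 < theta < 1) (theta_irr : irrational theta)
    (c_gt0 : forall n, (0 < c n)%N)
    (c_cfrac : cfrac R c n @[n --> \oo] --> theta) :
  let t := theta_seq theta in
  let B := tower_diagram t in
  let v0 : 'I_2 := ord0 in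
  let v1 : 'I_2 := ord_max in
  (forall n, [/\ (bV B n : Type) = 'I_2,
      (t n < 1 / 2 <-> (2 <= c n)%N) /\ (t n > 1 / 2 <-> c n = 1%N),
      t n < 1 / 2 ->
        [/\ @edge_count B n v0 v0 = 1%N, @edge_count B n v0 v1 = 1%N,
            @edge_count B n v1 v0 = c n & @edge_count B n v1 v1 = (c n - 1)%N],
      t n > 1 / 2 ->
        [/\ @edge_count B n v0 v0 = 1%N, @edge_count B n v0 v1 = 1%N,
            @edge_count B n v1 v0 = 1%N & @edge_count B n v1 v1 = 0%N]
    & range (@bs B n) = [set: bV B n] /\ range (@br B n) = [set: bV B n.+1]])
  /\ (exists! act, @natural_action R theta act)
  /\ (forall act, @natural_action R theta act ->
        Dinf_action (act 0%N) /\
        topologically_conjugate (act 0%N) (@X_act R theta)).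
Proof.
move=> t B v0 v1.
have ht : cf_seq t by exact: theta_seq_cf_seq.
have tc n : cf (t n) = c n by exact: cfrac_theta_seq.
have cf0 n : (0 < cf (t n))%N by rewrite tc.
have srcE n (e : bE B n) : bs e = (rank e != 0)%N :> nat.
  have [h0 hE] := ht n; have [h1 _] := ht n.+1.
  exact: floor_sourceE h0 h1 hE e.
have srcv n (e : bE B n) (j : 'I_2) :
    (bs e == j) = ((rank e != 0)%N == j :> nat)%N.
  exact: (congr1 (fun i => i == j :> nat)%N (srcE n e)).
(* An edge starts at 0 exactly when its rank is 0. So tower k, which has c + 1 - k floors, receives
   one edge from 0 and c - k edges from 1, whatever c is. *)
have count n : [/\ @edge_count B n v0 v0 = 1%N, @edge_count B n v0 v1 = 1%N,
    @edge_count B n v1 v0 = c n & @edge_count B n v1 v1 = (c n - 1)%N].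
  have E0 k : @edge_count B n v0 k =
      #|[pred i : 'I_((cf (t n)).+1 - k) | (i == 0 :> nat)%N]|.
    rewrite -(card_tower _ (fun i => i == 0%N) k); apply: eq_card => e.
    by rewrite !inE srcv; congr (_ && _); case: (rank e == 0)%N.
  have E1 k : @edge_count B n v1 k =
      #|[pred i : 'I_((cf (t n)).+1 - k) | (i != 0 :> nat)%N]|.
    rewrite -(card_tower _ (fun i => i != 0%N) k); apply: eq_card => e.
    by rewrite !inE srcv; congr (_ && _); case: (rank e == 0)%N.
  split; rewrite ?E0 ?E1 ?card_ord_neq0 ?card_ord_eq0 //= ?subSS ?subn0 //.
  by rewrite tc subn1.
have act0 i : cf_seq (iter i (@seq_shift R) t).
  by elim: i => [//|i IH]; exact: cf_seq_shift.
pose act i (p : Omega (tail_diagram theta i)) x := transport (act0 i) p x.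
have nact : natural_action act.
  by move=> i p; exact: (transport_natural (act0 i) (act0 i.+1) p).
split; [move=> n; have [t01 tirr] := theta_seq_itv theta01 theta_irr n|split].
- have [T1 T2] := cf_ge2 t01 tirr; rewrite tc in T1 T2.
  split=> //; first by move=> /T2 c1; have := count n; rewrite c1.
  have k1 (k : 'I_2) : (k <= cf (t n))%N.
    exact: leq_trans (ltn_ord k : (k <= 1)%N) (cf0 n).
  split; apply/seteqP; split=> //= k _.
    (* In tower 0 the floor of rank k has source k; for k = 1 it exists because c is positive. *)
    have [|e [_ er]] := @floors_exists (cf (t n)) ord0 k; first by rewrite addn0.
    by exists e => //; apply/eqP; rewrite srcv er; case: k {e er} => -[|[]].
  have [|e [ek _]] := @floors_exists (cf (t n)) k 0; first exact: k1.
  by exists e.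
- exists act; split=> // act' na'; exact: natural_uniq.
(* By uniqueness, only the transported action has to be considered; for it the conjugacy holds by
   construction. *)
- move=> act' na'; have -> := natural_uniq na' nact.
  split; last first.
    exists (point_of (act0 0%N)); split; first exact: point_of_homeomorphism.
    by move=> p g; rewrite /act /transport path_ofK.
  move=> g; split; first exact: natural_continuous.
  by move=> p; rewrite /act /transport path_ofK X_actK point_ofK.
Qed.
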